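(* Let $1\le p<2$, $\sigma_1,\sigma_2\in L_p[0,1]$, and let $D(x,\mu)$ be the solution of $$D'(x)+J(x)D(x)=A_\mu D(x),\quad x\in[0,1],\qquad D(0)=I.$$ For every $d>0$ there exist constants $c_j=c_j(d,\sigma_1,\sigma_2)$, $j=0,1,2$, such that for all $x\in[0,1]$ and $\mu\in P_d$: $$D(x,\mu)=e^{xA_\mu}+R(x,\mu),$$ where $$\|R(x,\mu)\|_{M(C[0,1])}\le c_0,\qquad \|R(x,\mu)\|_{M(\mathbb{C})}\le c_1(\gamma(\mu)+\gamma_0(x,\mu)).$$ Moreover, $$D(x,\mu)=e^{xA_\mu}+D_0(x,\mu)+R_0(x,\mu),$$ where $$D_0(x,\mu):=\int_0^x e^{(x-2t)A_\mu}\big(J(t)+\tilde J(x,t)\big)\,dt$$ and $$\|R_0(x,\mu)\|_{M(\mathbb{C})}\le c_2\big(\gamma(\mu)\gamma_0(x,\mu)+\gamma_2(\mu)\big),\qquad x\in[0,1].$$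
   Context: $J_0=\begin{pmatrix}1&0\\0&-1\end{pmatrix}$, $J(x)=\begin{pmatrix}0&\sigma_1(x)\\ \sigma_2(x)&0\end{pmatrix}$ with $\sigma_j$ complex-valued, $I$ the $2\times2$ identity, $A_\mu=i\mu J_0$, $\mu\in\mathbb{C}$. A solution has absolutely continuous entries on $[0,1]$ and satisfies the equation a.e. $P_d:=\{\mu\in\mathbb{C}:|\mathrm{Im}\,\mu|\le d\}$. For a Banach space $X$, $M(X)$ is the space of $2\times2$ matrices with entries in $X$, normed by the sum of the norms of the entries. For $0\le t\le x\le 1$, $\tilde J(x,t)=\int_0^{x-t}J(t+\xi)J(\xi)\,d\xi$. Let $q$ be given by $1/p+1/q=1$ ($q=\infty$ if $p=1$). Put $\sigma_0=|\sigma_1|+|\sigma_2|$, $a_1=\|\sigma_1\|_{L_1}+\|\sigma_2\|_{L_1}$, $a_2=\|\sigma_1\|_{L_p}+\|\sigma_2\|_{L_p}$ (norms on $[0,1]$), and $$\gamma_0(x,\mu)=\sum_{j=1}^2\Big(\Big|\int_0^x e^{-2i\mu t}\sigma_j(t)dt\Big|+\Big|\int_0^x e^{2i\mu t}\sigma_j(t)dt\Big|\Big),$$ $$\gamma(\mu)=\sum_{j=1}^2\Big(\Big\|\int_0^x e^{-2i\mu t}\sigma_j(t)dt\Big\|_{L_q}+\Big\|\int_0^x e^{2i\mu t}\sigma_j(t)dt\Big\|_{L_q}\Big),$$ where the $L_q$ norms are taken in the variable $x\in[0,1]$, and $$\gamma_1(\mu)=\int_0^1\sigma_0(s)\gamma_0^2(s,\mu)\,ds,\qquad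 \gamma_2(\mu)=a_2^2\gamma^2(\mu)+a_1\gamma_1(\mu).$$
   Formalization: In the definition of D_0 the term J(t) is taken with a minus sign, i.e. the integrand is e^{(x-2t)A_mu}(-J(t)+J~(x,t)); with the printed plus sign the bound on R_0 fails, e.g. for sigma_1=1, sigma_2=0 and large real mu. *)

(* Defs.v *)
(* MathComp-Analysis. The scalars are the real-closed library's R[i] over an
   abstract R : realType. Since R[i] is not a measurable or normed space over R
   there, limits, derivatives, measurability and integrals of complex-valued
   functions are taken on real and imaginary parts, and the modulus is the
   R-valued normc. *)
From HB Require Import structures.
From mathcomp Require Import all_boot all_order all_algebra.
From mathcomp Require Import all_classical all_reals all_analysis.
From mathcomp Require Import complex.
Set Implicit Arguments.
Unset Strict Implicit.
Unset Printing Implicit Defensive.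
Import Order.TTheory GRing.Theory Num.Theory.
Import numFieldNormedType.Exports.
Import Normc.

Local Open Scope classical_set_scope.
Local Open Scope ring_scope.
Local Open Scope complex_scope.

Section Complex.
Context {R : realType}.
Implicit Types (z mu : R[i]) (f : R -> R[i]) (a b d x : R).

Definition cexp z : R[i] :=
  (expR (complex.Re z) * cos (complex.Im z))
  +i* (expR (complex.Re z) * sin (complex.Im z)).

Definition clim (u : nat -> R[i]) : R[i] :=
  lim ((fun n => complex.Re (u n)) @ \oo) +i* lim ((fun n => complex.Im (u n)) @ \oo).

Definition cintegral a b f : R[i] :=
  (\int[lebesgue_measure]_(t in `[a, b]) complex.Re (f t))
  +i* (\int[lebesgue_measure]_(t in `[a, b]) complex.Im (f t)).

Definition cderive_at f x z : Prop :=
  is_derive x 1 (fun t => complex.Re (f t)) (complex.Re z) /\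
  is_derive x 1 (fun t => complex.Im (f t)) (complex.Im z).

Definition continuous01 f : Prop :=
  {within `[0 : R, 1], continuous (fun t => complex.Re (f t))} /\
  {within `[0 : R, 1], continuous (fun t => complex.Im (f t))}.

Definition abs_continuous01 f : Prop :=
  forall e : R, 0 < e -> exists2 delta : R, 0 < delta &
  forall (n : nat) (a b : 'I_n -> R),
    (forall i, 0 <= a i /\ a i <= b i /\ b i <= 1) ->
    trivIset setT (fun i => `]a i, b i[%classic) ->
    \sum_(i < n) (b i - a i) < delta ->
    \sum_(i < n) normc (f (b i) - f (a i)) < e.

(* The L_p[0,1] norm, through extension by zero; p = +oo is allowed. *)
Definition eLpnorm (p : \bar R) (f : R -> R[i]) : \bar R :=
  Lnorm lebesgue_measure p (EFin \o ((fun t => normc (f t)) \_ `[0, 1])).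

Definition Lpnorm (p : \bar R) (f : R -> R[i]) : R := fine (eLpnorm p f).

Definition in_Lp (p : \bar R) (f : R -> R[i]) : Prop :=
  [/\ measurable_fun `[0%R : R, 1%R] (fun t => complex.Re (f t)),
      measurable_fun `[0%R : R, 1%R] (fun t => complex.Im (f t))
    & (eLpnorm p f < +oo)%E].

Definition strip d : set R[i] := [set mu | `|complex.Im mu| <= d].

End Complex.

Section Matrices.
Context {R : realType}.
Implicit Types (A : 'M[R[i]]_2) (F : R -> 'M[R[i]]_2).

Definition mxexp A : 'M[R[i]]_2 :=
  \matrix_(i, j) clim (fun n => (\sum_(k < n) (k`!%:R^-1 : R[i]) *: A ^+ k) i j).

Definition mxintegral (a b : R) F : 'M[R[i]]_2 :=
  \matrix_(i, j) cintegral a b (fun t => F t i j).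

Definition mxderive_at F (x : R) A : Prop :=
  forall i j, cderive_at (fun t => F t i j) x (A i j).

(* The norm of M(X) for X the complex numbers. *)
Definition normMC A : R := \sum_i \sum_j normc (A i j).

(* The norm of M(X) for X = C[0,1]; extended-valued, hence infinite rather than
   a default value on unbounded entries. *)
Definition normMC01 F : \bar R :=
  (\sum_i \sum_j ereal_sup [set (normc (F x i j))%:E | x in `[0%R, 1%R]])%E.

End Matrices.

Section Dirac.
Context {R : realType}.
Variables (p : R) (sigma1 sigma2 : R -> R[i]).
Implicit Types (mu : R[i]) (x t : R).

Definition J0 : 'M[R[i]]_2 :=
  \matrix_(i, j) (if i == j then if i == ord0 then 1 else -1 else 0).

Definition J x : 'M[R[i]]_2 :=
  \matrix_(i, j)
    (if i == j then 0 else if i == ord0 then sigma1 x else sigma2 x).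

Definition Amu mu : 'M[R[i]]_2 := ('i%C * mu) *: J0.

Definition dirac_solution mu (D : R -> 'M[R[i]]_2) : Prop :=
  [/\ forall i j, abs_continuous01 (fun x => D x i j),
      {ae lebesgue_measure, forall x : R, 0 <= x <= 1 ->
         exists2 D', mxderive_at D x D' & D' + J x *m D x = Amu mu *m D x}
    & D 0 = 1%:M].

Definition expxA mu x : 'M[R[i]]_2 := mxexp (x%:C *: Amu mu).

Definition Jtilde x t : 'M[R[i]]_2 :=
  mxintegral 0 (x - t) (fun xi => J (t + xi) *m J xi).

(* The first two terms of the Neumann series of
     D(x) = e^{xA} - \int_0^x e^{(x-t)A} J(t) D(t) dt,
   using J(t) e^{tA} = e^{-tA} J(t); this is what fixes the minus sign of J(t).
   The source prints +J(t), with which the bound on the remainder R_0 fails: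
   for sigma1 = 1, sigma2 = 0 and real mu, the (1,2) entry of R_0(1,mu) would
   be -2 sin(mu)/mu, while gamma gamma_0 + gamma_2 = O(1/mu^2). *)
Definition D0 x mu : 'M[R[i]]_2 :=
  mxintegral 0 x (fun t => expxA mu (x - 2 * t) *m (- J t + Jtilde x t)).

Definition sigma0 t : R := normc (sigma1 t) + normc (sigma2 t).

Definition a1 : R := Lpnorm 1%E sigma1 + Lpnorm 1%E sigma2.

Definition a2 : R := Lpnorm p%:E sigma1 + Lpnorm p%:E sigma2.

Definition osc (sigma : R -> R[i]) (s : R) mu x : R[i] :=
  cintegral 0 x (fun t => cexp (s%:C * 'i%C * mu * t%:C) * sigma t).

Definition gamma0 x mu : R :=
  (normc (osc sigma1 (-2) mu x) + normc (osc sigma1 2 mu x)) +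
  (normc (osc sigma2 (-2) mu x) + normc (osc sigma2 2 mu x)).

Definition gamma mu : R :=
  let q := hoelder_conjugate p%:E in
  (Lpnorm q (osc sigma1 (-2) mu) + Lpnorm q (osc sigma1 2 mu)) +
  (Lpnorm q (osc sigma2 (-2) mu) + Lpnorm q (osc sigma2 2 mu)).

Definition gamma1 mu : R :=
  \int[lebesgue_measure]_(s in `[0, 1]) (sigma0 s * gamma0 s mu ^+ 2).

Definition gamma2 mu : R := a2 ^+ 2 * gamma mu ^+ 2 + a1 * gamma1 mu.

End Dirac.

(* Main.v *)
Require Import Defs.
From HB Require Import structures.
From mathcomp Require Import all_boot all_order all_algebra.
From mathcomp Require Import all_classical all_reals all_analysis.
From mathcomp Require Import complex.
From mathcomp Require Import measurable_realfun ess_sup_inf.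
From mathcomp Require Import ring lra.
Set Implicit Arguments.
Unset Strict Implicit.
Unset Printing Implicit Defensive.
Import Order.TTheory GRing.Theory Num.Theory.
Import numFieldNormedType.Exports.
Import Normc.

Local Open Scope classical_set_scope.
Local Open Scope ring_scope.
Local Open Scope complex_scope.

(** The idea of the proof is to remove the diagonal terms of the system.  Put
    w = i mu.  If (X, Y) is the first column of D, then u = e^{-wx} X and
    v = e^{wx} Y satisfy
      u' = - s1 v,  v' = - s2 u,  u(0) = 1,  v(0) = 0,
    where s1 = e^{-2wt} sigma1 and s2 = e^{2wt} sigma2; the second column, read
    from bottom to top, satisfies the same system with w replaced by -w and
    with sigma1 and sigma2 exchanged.  On the strip, |s_j| <= e^{2d} sigma0, so
    u and v are bounded by a constant depending on d and sigma0 only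
    ([gronwall]).

    Let S be the primitive of s2 vanishing at 0, which is one of the oscillating
    integrals of gamma_0, and let B be the integral of sigma0 gamma_0 over
    [0, 1]; Hoelder's inequality gives B <= a_2 gamma.  The function v + S u has
    derivative - S s1 v, where s2 no longer occurs; hence |v| is at most a
    constant times gamma_0(x) + B.  Inserted in u' = - s1 v this bounds |u - 1|
    by a constant times B alone, because gamma_0 is integrated against sigma0.
    Inserting the bound of v once more in - S s1 v bounds v + S by
    gamma_0(x) B + B^2 + gamma_1, and then u - 1 - T, whose derivative is
    - s1 (v + S) when T' = s1 S and T(0) = 0, by B^2 + gamma_1
    ([column_bounds]).

    Multiplied back by e^{wx} and e^{-wx}, the functions T and - S are the
    entries of D_0.  For - S this is immediate; for T the iterated integral that
    defines the diagonal of D_0 is taken over the triangle 0 <= t, 0 <= r,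
    t + r <= x and is evaluated by Fubini's theorem and the substitution
    s = t + r ([triangle_integral]).

    Solutions are only absolutely continuous, with an equation holding almost
    everywhere.  All the estimates come from one fact about such functions: if
    the derivative is nonpositive almost everywhere, the function is
    nonincreasing ([ac_nonincreasing]).  Its complex form [ac_mean_value] turns
    a pointwise bound of a derivative into a bound of an increment, so that no
    integral identity is needed for u and v. *)

(** * Absolutely continuous functions with nonpositive derivative *)

Section absolute_continuity.
Context {R : realType}.
Implicit Types (D : R -> R -> R) (f g : R -> R).
Notation mu := (@lebesgue_measure R).

(** Absolute continuity is stated for a function of two points instead of the
    increments of a given function: products, norms and Lipschitz images of
    absolutely continuous functions are then all instances of the comparison
    [ac_incr_dom].  The predicate [abs_continuous01 f] is by definition the case
    D a b = normc (f b - f a). *)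
Definition ac_incr D : Prop :=
  forall e : R, 0 < e -> exists2 delta : R, 0 < delta &
  forall (n : nat) (a b : 'I_n -> R),
    (forall i, 0 <= a i /\ a i <= b i /\ b i <= 1) ->
    trivIset setT (fun i => `]a i, b i[%classic) ->
    \sum_(i < n) (b i - a i) < delta ->
    \sum_(i < n) D (a i) (b i) < e.

Definition ac_real f := ac_incr (fun a b => `|f b - f a|).

Lemma ac_incr_dom (k1 k2 : R) D D1 D2 :
  0 <= k1 -> 0 <= k2 -> ac_incr D1 -> ac_incr D2 ->
  (forall a b, 0 <= a -> a <= b -> b <= 1 ->
     D a b <= k1 * D1 a b + k2 * D2 a b) ->
  ac_incr D.
Proof.
move=> k10 k20 h1 h2 hD e e0.
(* the +1 keeps the threshold meaningful when k = 0 *)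
have e1 (k : R) : 0 <= k -> 0 < e / (2 * (k + 1)).
  by move=> k0; rewrite divr_gt0// mulr_gt0// ltr_wpDl.
have ke (k : R) : 0 <= k -> k * (e / (2 * (k + 1))) < e / 2.
  move=> k0; rewrite mulrA ltr_pdivrMr; last by rewrite mulr_gt0// ltr_wpDl.
  by rewrite mulrA divfK// mulrC ltr_pM2l// ltrDl.
have [d1 d10 H1] := h1 _ (e1 _ k10).
have [d2 d20 H2] := h2 _ (e1 _ k20).
exists (Num.min d1 d2); first by rewrite lt_min d10.
move=> n a b hab tab; rewrite lt_min => /andP[lt1 lt2].
apply: (@le_lt_trans _ _ (\sum_(i < n) (k1 * D1 (a i) (b i) + k2 * D2 (a i) (b i)))).
  by apply: ler_sum => i _; have [? [? ?]] := hab i; exact: hD.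
rewrite big_split/= -!mulr_sumr [ltRHS]splitr; apply: ltrD.
  apply: le_lt_trans (ke _ k10); rewrite ler_wpM2l//; exact/ltW/H1.
by apply: le_lt_trans (ke _ k20); rewrite ler_wpM2l//; exact/ltW/H2.
Qed.

Lemma ac_incr_length : ac_incr (fun a b => b - a).
Proof. by move=> e e0; exists e. Qed.

Lemma sum_length_le (n : nat) (a b : 'I_n -> R) (U : set R) :
  measurable U ->
  (forall i, a i <= b i) ->
  trivIset setT (fun i => `]a i, b i[%classic) ->
  (forall i, `]a i, b i[%classic `<=` U) ->
  ((\sum_(i < n) (b i - a i))%:E <= mu U)%E.
Proof.
move=> mU ab tab abU.
have mB : measurable (\big[setU/set0]_(i < n) `]a i, b i[%classic).
  by apply: bigsetU_measurable => i _; exact: measurable_itv.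
have -> : (\sum_(i < n) (b i - a i))%:E = mu (\big[setU/set0]_(i < n) `]a i, b i[%classic).
  rewrite measure_semi_additive_ord//= -sumEFin; apply: eq_bigr => i _.
  rewrite lebesgue_measure_itv/= lte_fin; case: ltP => // ba.
  by rewrite (@le_anti _ _ (b i) (a i)) ?subrr// ba ab.
apply: le_measure; rewrite ?inE//.
by rewrite -bigcup_seq => x [i _]; exact: abU.
Qed.

Lemma is_derive_linear_bound f (c l e : R) : is_derive c 1 f l -> 0 < e ->
  exists2 r, 0 < r & forall y, `|y - c| < r ->
    `|f y - f c - l * (y - c)| <= e * `|y - c|.
Proof.
move=> [df vf] e0.
have : (fun h : R => h^-1 *: ((f \o shift c) (h *: 1) - f c)) @ 0^' --> l.
  by rewrite -vf; exact: df.
move=> /cvgrPdist_le/(_ _ e0); rewrite near_withinE => -[r /= r0 hr].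
exists r => // y yr; have [->|yc] := eqVneq y c; first by rewrite !subrr mulr0 subrr !normr0 mulr0.
have h0 : y - c != 0 by rewrite subr_eq0.
have := hr (y - c); rewrite /ball/= sub0r normrN => /(_ yr h0).
rewrite /shift/= /GRing.scale/= mulr1 subrK => h.
rewrite (_ : f y - f c - _ = (y - c) * ((y - c)^-1 * (f y - f c) - l)); last first.
  by field.
by rewrite normrM mulrC ler_wpM2r// distrC.
Qed.

(** The ordering of the list makes it possible to append an interval at the
    right end, which is the inductive step of [ac_nonincreasing], and still
    yields the disjoint families required by [ac_incr]. *)
Definition interval_chain (s : seq (R * R)) : Prop :=
  (forall k, (k < size s)%N -> (nth (0, 0) s k).1 <= (nth (0, 0) s k).2) /\
  (forall j k, (j < k)%N -> (k < size s)%N ->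
     (nth (0, 0) s j).2 <= (nth (0, 0) s k).1).

Lemma interval_chain_trivIset s : interval_chain s ->
  trivIset setT (fun i : 'I_(size s) =>
    `](nth (0, 0) s i).1, (nth (0, 0) s i).2[%classic).
Proof.
move=> [_ h]; apply/trivIsetP => i j _ _ ij.
wlog lij : i j ij / (i < j)%N.
  move=> hw; have /orP[?|?] : (i < j)%N || (j < i)%N by rewrite -neq_ltn.
    exact: hw.
  by rewrite setIC; apply: hw => //; rewrite eq_sym.
rewrite -subset0 => x []/=; rewrite !in_itv/= => /andP[_ xi] /andP[jx _].
by have := lt_le_trans xi (h i j lij (ltn_ord j)); rewrite ltNge (ltW jx).
Qed.

Lemma interval_chain_rcons s (y z : R) : interval_chain s ->
  (forall k, (k < size s)%N -> (nth (0, 0) s k).2 <= y) -> y <= z ->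
  interval_chain (rcons s (y, z)).
Proof.
move=> [h1 h2] hy yz; split=> [k|j k jk]; rewrite size_rcons ltnS leq_eqVlt.
  move=> /orP[/eqP->|ks]; first by rewrite nth_rcons ltnn eqxx.
  by rewrite nth_rcons ks; exact: h1.
move=> /orP[/eqP ks|ks].
  by rewrite !nth_rcons -ks jk ltnn eqxx; apply: hy; rewrite -ks.
by rewrite !nth_rcons ks (ltn_trans jk ks); exact: h2.
Qed.

(** Continuous induction, as in Cousin's lemma.  Around a point outside N the
    increments of f over short intervals straddling the point are at most e/2
    times their length.  The set N is covered by an open set U of measure less
    than the delta that absolute continuity attaches to e/2, so the increments
    over any disjoint intervals inside U add up to less than e/2.  Climbing from
    0 to x with intervals of these two kinds gives f x <= f 0 + e. *)
Lemma ac_nonincreasing f (N : set R) (x : R) :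
  ac_real f -> mu.-negligible N ->
  (forall t, 0 <= t <= 1 -> ~ N t ->
     exists2 l, is_derive t 1 f l & l <= 0) ->
  0 <= x <= 1 -> f x <= f 0.
Proof.
move=> acf negN hf /andP[x0 x1].
apply/ler_addgt0Pr => e e0.
have e20 : 0 < e / 2 by rewrite divr_gt0.
have [d d0 Hd] := acf _ e20.
have [M [mM M0 NM]] := negN.
have [U [oU MU]] : exists U : set R, [/\ open U, M `<=` U & (mu (U `\` M) < d%:E)%E].
  have Mfin : (mu M < +oo)%E by rewrite [X in (X < _)%E]M0.
  exact: lebesgue_regularity_outer.
move=> muUM.
have mU : measurable U by exact: measurable_realfun.open_measurable.
have muU : (mu U < d%:E)%E.
  apply: le_lt_trans muUM; rewrite [leLHS](measureDI mu mU mM).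
  have UM0 : mu (U `&` M) = 0%E.
    by apply: (subset_measure0 _ mM _ M0); [exact: measurableI|exact: subIsetr].
  by rewrite [X in (_ + X <= _)%E]UM0 adde0.
(* s lists the intervals inside U used to climb from 0 to y *)
pose P y s := [/\ interval_chain s,
   forall k, (k < size s)%N -> 0 <= (nth (0, 0) s k).1 /\ (nth (0, 0) s k).2 <= y,
   forall k, (k < size s)%N -> `](nth (0, 0) s k).1, (nth (0, 0) s k).2[%classic `<=` U &
   f y - f 0 <= e / 2 * y + \sum_(k < size s) `|f (nth (0, 0) s k).2 - f (nth (0, 0) s k).1|].
have concl : (exists s, P x s) -> f x <= f 0 + e.
  move=> [s [cs bs Us hs]]; rewrite -lerBlDl (le_trans hs)// [leRHS]splitr.
  apply: lerD; first by rewrite ler_piMr// ltW.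
  apply/ltW/Hd.
  - move=> i; have [? ?] := bs i (ltn_ord i); split => //; split.
      by case: cs => + _; apply.
    exact: le_trans x1.
  - exact: interval_chain_trivIset.
  - rewrite -lte_fin; apply: le_lt_trans muU; apply: sum_length_le => //.
    + by move=> i; case: cs => + _; apply.
    + exact: interval_chain_trivIset.
    + by move=> i; apply: Us.
apply: concl.
pose S := [set y | 0 <= y <= x /\ exists s, P y s].
have S0 : S 0.
  split; first by rewrite lexx.
  by exists [::]; split=> //; rewrite big_ord0 mulr0 subrr addr0.
have supS : has_sup S by split; [exists 0|exists x => y [/andP[]]].
set c := sup S.
have c0 : 0 <= c by apply: ub_le_sup => //; exact: supS.2.
have cx : c <= x by apply: ge_sup; [exists 0|move=> y [/andP[]]].
(* a point reached just before c gives access to points beyond c *)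
have [r r0 ext] : exists2 r, 0 < r & forall y z, c - r < y -> y <= c -> c <= z ->
    z < c + r -> z <= x -> S y -> exists s, P z s.
  have [Mc|Mc] := pselect (M c).
    have Uc : nbhs c U by apply: open_nbhs_nbhs; split => //; exact: MU.
    have [r /= r0 rU] := (nbhs_ballP c U).1 Uc.
    exists r => // y z cry yc cz zcr zx [/andP[y0 yx] [s [cs bs Us hs]]].
    have yz : y <= z by exact: le_trans cz.
    exists (rcons s (y, z)); split.
    - by apply: interval_chain_rcons => // k /bs[].
    - move=> k; rewrite size_rcons ltnS leq_eqVlt => /orP[/eqP->|ks].
        by rewrite nth_rcons ltnn eqxx.
      rewrite nth_rcons ks; have [? /le_trans h] := bs k ks; split => //; exact: h.
    - move=> k; rewrite size_rcons ltnS leq_eqVlt => /orP[/eqP->|ks]; last first.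
        by rewrite nth_rcons ks; exact: Us.
      rewrite nth_rcons ltnn eqxx/= => t; rewrite /= in_itv/= => /andP[yt tz].
      apply: rU; rewrite /ball/= distrC ltr_distl; apply/andP; split; first exact: lt_trans yt.
      exact: lt_trans zcr.
    - rewrite size_rcons big_ord_recr/= nth_rcons ltnn eqxx/=.
      rewrite (_ : f z - f 0 = (f y - f 0) + (f z - f y)); last by ring.
      rewrite [leRHS]addrA; apply: lerD; last exact: ler_norm.
      apply: (le_trans hs); apply: lerD; first by rewrite ler_pM2l.
      by apply: ler_sum => k _; rewrite nth_rcons ltn_ord.
  have c01 : 0 <= c <= 1 by rewrite c0 (le_trans cx).
  have [l dl l0] := hf c c01 (fun h => Mc (NM _ h)).
  have [r r0 hr] := is_derive_linear_bound dl e20.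
  exists r => // y z cry yc cz zcr zx [/andP[y0 yx] [s [cs bs Us hs]]].
  have yz : y <= z by exact: le_trans cz.
  exists s; split => //.
    by move=> k ks; have [? /le_trans h] := bs k ks; split => //; exact: h.
  have := hr y; rewrite distrC ger0_norm ?subr_ge0// ltrBlDr -ltrBlDl => /(_ cry).
  have := hr z; rewrite [in X in (X -> _) -> _]ger0_norm ?subr_ge0// ltrBlDl => /(_ zcr).
  rewrite (ger0_norm (_ : 0 <= z - c)) ?subr_ge0//.
  rewrite !ler_norml => /andP[_ hz] /andP[hy _].
  move: hz hy hs; set Sg := \sum_(_ < _) _ => hz hy hs.
  have : l * (z - c) <= 0 by rewrite mulr_le0_ge0// subr_ge0.
  have : l * (c - y) <= 0 by rewrite mulr_le0_ge0// subr_ge0.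
  nra.
have [y Sy yc] := sup_adherent r0 supS.
have yc' : y <= c by apply: ub_le_sup => //; exact: supS.2.
have [xcr|xcr] := ltP x (c + r); first exact: (ext y x).
have zc : c < c + r / 2 by rewrite ltrDl divr_gt0.
have zx : c + r / 2 < c + r by rewrite ltrD2l gtr_pMr// invf_lt1// ltr1n.
have zx' : c + r / 2 <= x by exact: ltW (lt_le_trans zx xcr).
have : S (c + r / 2).
  split; first by rewrite zx' andbT addr_ge0// ltW// divr_gt0.
  exact: (ext y _ yc yc' (ltW zc)).
by move=> /(ub_le_sup supS.2); rewrite leNgt zc.
Qed.
End absolute_continuity.

(** * Complex-valued functions on the unit interval *)

Section complex_modulus.
Context {R : realType}.
Implicit Types (z w : R[i]).

Lemma normc_nneg z : 0 <= normc z.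
Proof. by case: z => a b /=; exact: sqrtr_ge0. Qed.

Lemma normc_add z w : normc (z + w) <= normc z + normc w.
Proof. exact: (@le_normcD R z w). Qed.

Lemma normc_opp z : normc (- z) = normc z.
Proof. exact: (@normcN R z). Qed.

Lemma normc_sub z w : normc (z - w) <= normc z + normc w.
Proof. by rewrite (le_trans (normc_add _ _))// normc_opp. Qed.

Lemma normc_Re z : `|complex.Re z| <= normc z.
Proof.
case: z => a b /=; rewrite -sqrtr_sqr ler_sqrt ?addr_ge0 ?sqr_ge0//.
by rewrite lerDl sqr_ge0.
Qed.

Lemma normc_Im z : `|complex.Im z| <= normc z.
Proof.
case: z => a b /=; rewrite -sqrtr_sqr ler_sqrt ?addr_ge0 ?sqr_ge0//.
by rewrite lerDr sqr_ge0.
Qed.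

Lemma normc_ReIm z : normc z <= `|complex.Re z| + `|complex.Im z|.
Proof.
case: z => a b /=; rewrite -[leRHS]ger0_norm ?addr_ge0// -sqrtr_sqr.
rewrite ler_sqrt ?sqr_ge0// sqrrD !real_normK ?num_real//.
have := mulr_ge0 (normr_ge0 a) (normr_ge0 b); lra.
Qed.

Lemma normc_sqr z : normc z ^+ 2 = complex.Re z ^+ 2 + complex.Im z ^+ 2.
Proof. by case: z => a b /=; rewrite sqr_sqrtr// addr_ge0// sqr_ge0. Qed.

Lemma ReD z w : complex.Re (z + w) = complex.Re z + complex.Re w.
Proof. by case: z; case: w. Qed.
Lemma ImD z w : complex.Im (z + w) = complex.Im z + complex.Im w.
Proof. by case: z; case: w. Qed.
Lemma ReN z : complex.Re (- z) = - complex.Re z. Proof. by case: z. Qed.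
Lemma ImN z : complex.Im (- z) = - complex.Im z. Proof. by case: z. Qed.
Lemma ReM z w : complex.Re (z * w) =
  complex.Re z * complex.Re w - complex.Im z * complex.Im w.
Proof. by case: z; case: w. Qed.
Lemma ImM z w : complex.Im (z * w) =
  complex.Re z * complex.Im w + complex.Im z * complex.Re w.
Proof. by case: z => a b; case: w => c d/=. Qed.

Lemma complex_eq z w : complex.Re z = complex.Re w ->
  complex.Im z = complex.Im w -> z = w.
Proof. by case: z => a b; case: w => c d /= -> ->. Qed.

End complex_modulus.

Section complex_calculus.
Context {R : realType}.
Implicit Types (f g : R -> R[i]) (x : R) (z w : R[i]).
Notation mu := (@lebesgue_measure R).

Lemma cderive_cst z x : cderive_at (fun _ => z) x 0.
Proof. by split; exact: is_derive_cst. Qed.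

Lemma cderiveD f g x z w : cderive_at f x z -> cderive_at g x w ->
  cderive_at (fun t => f t + g t) x (z + w).
Proof.
move=> [f1 f2] [g1 g2]; split; rewrite ?ReD ?ImD.
  rewrite (_ : (fun _ => _) = (fun t => complex.Re (f t)) + (fun t => complex.Re (g t))).
    exact: is_deriveD.
  by apply/funext => t; rewrite ReD.
rewrite (_ : (fun _ => _) = (fun t => complex.Im (f t)) + (fun t => complex.Im (g t))).
  exact: is_deriveD.
by apply/funext => t; rewrite ImD.
Qed.

Lemma cderiveN f x z : cderive_at f x z -> cderive_at (fun t => - f t) x (- z).
Proof.
move=> [f1 f2]; split; rewrite ?ReN ?ImN.
  rewrite (_ : (fun _ => _) = - (fun t => complex.Re (f t))).
    exact: is_deriveN.
  by apply/funext => t; rewrite ReN.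
rewrite (_ : (fun _ => _) = - (fun t => complex.Im (f t))).
  exact: is_deriveN.
by apply/funext => t; rewrite ImN.
Qed.

Lemma cderiveM f g x z w : cderive_at f x z -> cderive_at g x w ->
  cderive_at (fun t => f t * g t) x (z * g x + f x * w).
Proof.
move=> [f1 f2] [g1 g2]; split; rewrite ?ReD ?ImD !(ReM, ImM).
  rewrite (_ : (fun _ => _) =
    (fun t => complex.Re (f t)) * (fun t => complex.Re (g t)) -
    (fun t => complex.Im (f t)) * (fun t => complex.Im (g t))).
    apply: (is_derive_eq (is_deriveB (is_deriveM f1 g1) (is_deriveM f2 g2))).
    by rewrite /GRing.scale/=; ring.
  by apply/funext => t; rewrite ReM.
rewrite (_ : (fun _ => _) =
    (fun t => complex.Re (f t)) * (fun t => complex.Im (g t)) +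
    (fun t => complex.Im (f t)) * (fun t => complex.Re (g t))).
  apply: (is_derive_eq (is_deriveD (is_deriveM f1 g2) (is_deriveM f2 g1))).
  by rewrite /GRing.scale/=; ring.
by apply/funext => t; rewrite ImM.
Qed.

Lemma ac_Re f : abs_continuous01 f -> ac_real (fun t => complex.Re (f t)).
Proof.
move=> acf; apply: (@ac_incr_dom R 1 0 _ _ _ ler01 (lexx 0) acf (@ac_incr_length R)).
by move=> a b _ _ _; rewrite mul1r mul0r addr0 -ReN -ReD; exact: normc_Re.
Qed.

Lemma ac_Im f : abs_continuous01 f -> ac_real (fun t => complex.Im (f t)).
Proof.
move=> acf; apply: (@ac_incr_dom R 1 0 _ _ _ ler01 (lexx 0) acf (@ac_incr_length R)).
by move=> a b _ _ _; rewrite mul1r mul0r addr0 -ImN -ImD; exact: normc_Im.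
Qed.

Lemma ac_ReIm f : ac_real (fun t => complex.Re (f t)) ->
  ac_real (fun t => complex.Im (f t)) -> abs_continuous01 f.
Proof.
move=> ac1 ac2; apply: (@ac_incr_dom R 1 1 (fun a b => normc (f b - f a)) _ _ ler01 ler01 ac1 ac2).
by move=> a b _ _ _; rewrite !mul1r -ReN -ReD -ImN -ImD; exact: normc_ReIm.
Qed.

Lemma ac_real_continuous (h : R -> R) : ac_real h ->
  {within `[0, 1], continuous h}.
Proof.
move=> ach; apply/subspace_continuousP => x /=; rewrite in_itv/= => /andP[x0 x1].
apply/cvgrPdist_lt => e e0; have [d d0 hd] := ach _ e0.
have H a b : 0 <= a -> a <= b -> b <= 1 -> b - a < d -> `|h b - h a| < e.
  move=> a0 ab b1 bad.
  have := hd 1%N (fun=> a) (fun=> b); rewrite !big_ord1; apply => //.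
  by apply/trivIsetP => i j _ _; rewrite !ord1.
rewrite near_withinE; near=> t; rewrite /= in_itv/= => /andP[t0 t1].
have : `|x - t| < d by near: t; exact: nbhsx_ballx.
have [xt|tx] := leP x t.
  by rewrite distrC ger0_norm ?subr_ge0// distrC => ?; exact: H.
by rewrite gtr0_norm ?subr_gt0// => ?; apply: H => //; exact: ltW.
Unshelve. all: by end_near. Qed.

Lemma ac_continuous01 f : abs_continuous01 f -> continuous01 f.
Proof. by move=> acf; split; apply: ac_real_continuous; [exact: ac_Re|exact: ac_Im]. Qed.

Lemma ac_real_bounded (h : R -> R) : ac_real h ->
  exists2 M, 0 <= M & forall x, 0 <= x <= 1 -> `|h x| <= M.
Proof.
move=> /ac_real_continuous ch.
have := continuous_compact ch (@segment_compact R 0 1).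
move=> /compact_bounded[M [Mr hM]].
exists (`|M| + 1) => [|x x01]; first by rewrite addr_ge0.
apply: (hM (`|M| + 1)); first by rewrite (le_lt_trans (ler_norm _))// ltrDl.
by exists x; rewrite //= in_itv.
Qed.

Lemma ac_bounded f : abs_continuous01 f ->
  exists2 M, 0 <= M & forall x, 0 <= x <= 1 -> normc (f x) <= M.
Proof.
move=> acf; have [M1 M10 h1] := ac_real_bounded (ac_Re acf).
have [M2 M20 h2] := ac_real_bounded (ac_Im acf).
exists (M1 + M2) => [|x x01]; first exact: addr_ge0.
by rewrite (le_trans (normc_ReIm _))// lerD ?h1 ?h2.
Qed.

Lemma ac_realM (f g : R -> R) : ac_real f -> ac_real g ->
  ac_real (fun t => f t * g t).
Proof.
move=> acf acg.
have [M1 M10 h1] := ac_real_bounded acf; have [M2 M20 h2] := ac_real_bounded acg.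
apply: (@ac_incr_dom R M2 M1 _ _ _ M20 M10 acf acg) => a b a0 ab b1.
rewrite (_ : _ - _ = (f b - f a) * g b + f a * (g b - g a)); last by ring.
rewrite (le_trans (ler_normD _ _))// !normrM lerD//.
  by rewrite mulrC ler_wpM2r// h2// b1 (le_trans a0).
by rewrite ler_wpM2r// h1// a0 (le_trans ab).
Qed.

Lemma acM f g : abs_continuous01 f -> abs_continuous01 g ->
  abs_continuous01 (fun t => f t * g t).
Proof.
move=> acf acg.
have [M1 M10 h1] := ac_bounded acf; have [M2 M20 h2] := ac_bounded acg.
apply: (@ac_incr_dom R M2 M1 (fun a b => normc (f b * g b - f a * g a)) _ _ M20 M10 acf acg) => a b a0 ab b1.
rewrite (_ : _ - _ = (f b - f a) * g b + f a * (g b - g a)); last by ring.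
rewrite (le_trans (normc_add _ _))// !normcM lerD//.
  by rewrite [leLHS]mulrC; apply: ler_wpM2r; [exact: normc_nneg|rewrite h2// b1 (le_trans a0)].
by apply: ler_wpM2r; [exact: normc_nneg|rewrite h1// a0 (le_trans ab)].
Qed.

Lemma acD f g : abs_continuous01 f -> abs_continuous01 g ->
  abs_continuous01 (fun t => f t + g t).
Proof.
move=> acf acg.
apply: (@ac_incr_dom R 1 1 (fun a b => normc ((f b + g b) - (f a + g a))) _ _ ler01 ler01 acf acg) => a b a0 ab b1.
rewrite (_ : _ - _ = (f b - f a) + (g b - g a)); last by ring.
by rewrite !mul1r; exact: normc_add.
Qed.

Lemma acN f : abs_continuous01 f -> abs_continuous01 (fun t => - f t).
Proof.
move=> acf.
apply: (@ac_incr_dom R 1 0 (fun a b => normc (- f b - - f a)) _ _ ler01 (lexx 0) acf (@ac_incr_length R)) => a b a0 ab b1.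
by rewrite mul1r mul0r addr0 -opprD le_eqVlt; apply/orP; left; apply/eqP; exact: normc_opp.
Qed.

Lemma ac_cst z : abs_continuous01 (fun _ : R => z).
Proof.
apply: (@ac_incr_dom R 1 0 (fun a b => normc (z - z)) _ _ ler01 (lexx 0) (@ac_incr_length R) (@ac_incr_length R)).
by move=> a b a0 ab b1; rewrite subrr normc0 mul1r mul0r addr0 subr_ge0.
Qed.

Lemma ac_realB (f g : R -> R) : ac_real f -> ac_real g ->
  ac_real (fun t => f t - g t).
Proof.
move=> acf acg.
apply: (@ac_incr_dom R 1 1 _ _ _ ler01 ler01 acf acg) => a b a0 ab b1.
rewrite (_ : _ - _ = (f b - f a) - (g b - g a)); last by ring.
by rewrite !mul1r ler_normB.
Qed.

Lemma ac_realD (f g : R -> R) : ac_real f -> ac_real g -> ac_real (fun t => f t + g t).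
Proof.
move=> acf acg; apply: (@ac_incr_dom R 1 1 _ _ _ ler01 ler01 acf acg) => a b a0 ab b1.
by rewrite /= (_ : _ - _ = (f b - f a) + (g b - g a)); [rewrite !mul1r ler_normD|ring].
Qed.

End complex_calculus.

(** * Primitives and the mean value inequality *)

(** This lets [filterS] combine statements that hold almost everywhere. *)
#[export] Instance ae_lebesgue_filter (R : realType) :
  Filter (almost_everywhere (@lebesgue_measure R)).
Proof. exact: ae_filter_ringOfSetsType. Qed.

Section primitives.
Context {R : realType}.
Implicit Types (f g : R -> R[i]) (h : R -> R) (x : R) (z w : R[i]).
Notation mu := (@lebesgue_measure R).
Notation rint h := (mu.-integrable setT (EFin \o h)).

Lemma rint_itv h (i : interval R) : rint h -> mu.-integrable [set` i] (EFin \o h).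
Proof. by move=> ih; apply: (integrableS measurableT) => //; exact: measurable_itv. Qed.

Lemma prim_incr h a b : rint h -> 0 <= a -> a <= b ->
  \int[mu]_(t in `[0, b]) h t - \int[mu]_(t in `[0, a]) h t =
  \int[mu]_(t in `]a, b[) h t.
Proof.
move=> ih a0 ab; rewrite Rintegral_itvB ?bnd_simp//; last exact: rint_itv.
by rewrite -Rintegral_itv_bndo_bndc//; exact: rint_itv.
Qed.

(** The sum of the increments is at most the integral of |h| over the union of
    the intervals, which is small with the measure of that union. *)
Lemma ac_prim h : rint h -> ac_real (fun x => \int[mu]_(t in `[0, x]) h t).
Proof.
move=> ih e e0.
have [d [d0 hd]] := integral_normr_continuous ih e0.
exists d => // n a b hab tab lab.
set U := \big[setU/set0]_(i < n) `]a i, b i[%classic.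
have mU : measurable U by apply: bigsetU_measurable => i _; exact: measurable_itv.
have muU : mu U = (\sum_(i < n) (b i - a i))%:E.
  rewrite measure_semi_additive_ord//= -sumEFin; apply: eq_bigr => i _.
  have [_ [ab _]] := hab i.
  rewrite lebesgue_measure_itv/= lte_fin; case: ltP => // ba.
  by rewrite (@le_anti _ _ (b i) (a i)) ?subrr// ba ab.
apply: le_lt_trans (hd U mU _); last by rewrite [X in (X < _)%E]muU lte_fin.
have inh : rint (fun t => `|h t|) by exact: integrable_norm.
have iU : mu.-integrable U (EFin \o (fun t => `|h t|)).
  exact: (integrableS measurableT).
rewrite -lee_fin fineK; last exact: integrable_fin_num.
rewrite ge0_integral_bigsetU//=; [|by rewrite /index_enum -enumT enum_uniq|
  by apply: (@sub_trivIset _ _ _ setT)|by case/integrableP: iU].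
rewrite -sumEFin. apply: lee_sum => i _; have [a0 [ab b1]] := hab i.
have ihi : mu.-integrable `]a i, b i[%classic (EFin \o h) by exact: rint_itv.
rewrite prim_incr// EFin_normr_Rintegral//.
exact: (le_abse_integral mu (measurable_itv _) (measurable_int mu ihi)).
Qed.

(** Lebesgue's differentiation theorem.  The derivative is two-sided even at 0,
    which is possible because the single point 0 is negligible. *)
Lemma ae_prim h : rint h -> {ae mu, forall x, 0 <= x ->
  is_derive x 1 (fun x => \int[mu]_(t in `[0, x]) h t) (h x)}.
Proof.
move=> ih.
have lh : locally_integrable [set: R] h by apply: open_integrable_locally => //; exact: openT.
have h0 : {ae mu, forall x : R, x != 0}.
  exists [set 0]; split; [exact: measurable_set1|exact: lebesgue_measure_set1|].
  by move=> x /= /negP; rewrite negbK => /eqP.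
have := FTC1 (a := BLeft 0) (fun y => rint_itv _ ih) lh.
apply: filterS2 h0 => x xn0 hx x0.
have [|dx vx] := hx; first by rewrite lte_fin lt_neqAle eq_sym xn0.
by split; [exact: dx|rewrite -derive1E; exact: vx].
Qed.

Definition cintegrable f := rint (fun t => complex.Re (f t)) /\
  rint (fun t => complex.Im (f t)).

Lemma ac_cprim f : cintegrable f -> abs_continuous01 (fun x => cintegral 0 x f).
Proof. by move=> [i1 i2]; apply: ac_ReIm => /=; exact: ac_prim. Qed.

Lemma ae_cprim f : cintegrable f -> {ae mu, forall x, 0 <= x ->
  cderive_at (fun x => cintegral 0 x f) x (f x)}.
Proof.
move=> [/ae_prim h1 /ae_prim h2].
by apply: filterS2 h1 h2 => x h1 h2 x0; split; [exact: h1|exact: h2].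
Qed.

Lemma cprim0 f : cintegral 0 0 f = 0.
Proof. by rewrite /cintegral set_itv1 !Rintegral_set1. Qed.

(** The difference of F and the primitive of g has nonpositive derivative. *)
Lemma ac_real_mean_value (F g : R -> R) x : ac_real F ->
  rint g -> (forall t, 0 <= g t) ->
  {ae mu, forall t : R, 0 <= t <= 1 -> exists2 l : R, is_derive t 1 F l & l <= g t} ->
  0 <= x <= 1 -> F x - F 0 <= \int[mu]_(t in `[0, 1]) g t.
Proof.
move=> acF ig g0 hF x01.
pose G y := \int[mu]_(t in `[0, y]) g t.
have G0 : G 0 = 0 by rewrite /G set_itv1 Rintegral_set1.
have Gx1 : G x <= G 1.
  case/andP: x01 => x0 x1.
  rewrite -subr_ge0 prim_incr//.
  by apply: Rintegral_ge0 => t _; exact: g0.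
have /ae_prim hG := ig.
have negN : mu.-negligible (~` [set t : R | 0 <= t <= 1 ->
    exists2 l : R, is_derive t 1 (fun y => F y - G y) l & l <= 0]).
  apply: filterS2 hF hG => t hF hG t01.
  have [l dl lg] := hF t01; exists (l - g t); last by rewrite subr_le0.
  have := hG (andP t01).1 => dG.
  exact: is_deriveB.
have acFG : ac_real (fun y => F y - G y) by apply: ac_realB => //; exact: ac_prim.
have := @ac_nonincreasing R _ _ x acFG negN _ x01.
rewrite G0 subr0 => H.
have {}H : F x - G x <= F 0.
  by apply: H => t t01 Nt; move/contrapT : Nt => /(_ t01).
rewrite lerBlDr; move: H; rewrite lerBlDr => /le_trans; apply.
by rewrite addrC lerD2r.
Qed.

(** The mean value inequality that replaces integration of the equation.  The
    factor 2 comes from treating the real and imaginary parts separately. *)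
Lemma ac_mean_value (F : R -> R[i]) (g : R -> R) x : abs_continuous01 F ->
  mu.-integrable `[0, 1]%classic (EFin \o g) -> (forall t, 0 <= g t) ->
  {ae mu, forall t : R, 0 <= t <= 1 -> exists2 F', cderive_at F t F' & normc F' <= g t} ->
  0 <= x <= 1 -> normc (F x - F 0) <= 2 * \int[mu]_(t in `[0, 1]) g t.
Proof.
move=> acF ig g0 hF x01.
pose h := g \_ `[0, 1].
have hg t : 0 <= t <= 1 -> h t = g t by move=> t01; rewrite /h patchE mem_set//= in_itv.
have ih : rint h.
  rewrite /h -restrict_EFin.
  have mI : measurable (`[0, 1]%classic : set R) by exact: measurable_itv.
  exact: ((@integrable_mkcond _ (measurableTypeR R) R mu _ (EFin \o g) mI).1 ig).
have h0 t : 0 <= h t by rewrite /h patchE; case: ifP.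
have -> : \int[mu]_(t in `[0, 1]) g t = \int[mu]_(t in `[0, 1]) h t.
  by apply: eq_Rintegral => t; rewrite inE/= in_itv/= => /hg.
rewrite (le_trans (normc_ReIm _))// mulr_natl mulr2n.
have H (k : R -> R) : ac_real k -> ac_real (fun t => - k t) ->
    {ae mu, forall t : R, 0 <= t <= 1 -> exists2 l : R, is_derive t 1 k l & `|l| <= h t} ->
    `|k x - k 0| <= \int[mu]_(t in `[0, 1]) h t.
  move=> k1 k2 hk; rewrite ler_norml; apply/andP; split.
    rewrite lerNl opprB -[k 0]opprK addrC.
    apply: (ac_real_mean_value k2) => //.
    apply: filterS hk => t hk t01; have [l dl lh] := hk t01.
    exists (- l); first exact: is_deriveN.
    by rewrite (le_trans (ler_norm _))// normrN.
  apply: (ac_real_mean_value k1) => //.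
  apply: filterS hk => t hk t01; have [l dl lh] := hk t01.
  by exists l => //; rewrite (le_trans (ler_norm _)).
have acNF := acN acF.
rewrite ReD ReN ImD ImN lerD//.
  apply: H (ac_Re acF) _ _.
    by have := ac_Re acNF; under eq_fun do rewrite ReN.
  apply: filterS hF => t hF t01; have [l [dl _] lh] := hF t01.
  by exists (complex.Re l) => //; rewrite hg// (le_trans (normc_Re _)).
apply: H (ac_Im acF) _ _.
  by have := ac_Im acNF; under eq_fun do rewrite ImN.
apply: filterS hF => t hF t01; have [l [_ dl] lh] := hF t01.
by exists (complex.Im l) => //; rewrite hg// (le_trans (normc_Im _)).
Qed.

End primitives.

(** * Gronwall's inequality *)

Section column.
Context {R : realType}.
Implicit Types (u v s S T : R -> R[i]) (sg G : R -> R) (x t K A : R).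
Notation mu := (@lebesgue_measure R).
Notation int01 h := (mu.-integrable `[0, 1]%classic (EFin \o h)).
Notation I01 h := (\int[mu]_(t in `[0, 1]) h t).

Lemma measurable01 : measurable (`[0%R : R, 1%R]%classic : set (measurableTypeR R)).
Proof. exact: measurable_itv. Qed.

Lemma int01Z k (h : R -> R) : int01 h -> int01 (fun t => k * h t).
Proof.
move=> ih; apply: eq_integrable; [exact: measurable01| |exact: (integrableZl measurable01 k ih)].
by move=> t _ /=; rewrite EFinM.
Qed.

Lemma int01D (h1 h2 : R -> R) : int01 h1 -> int01 h2 ->
  int01 (fun t => h1 t + h2 t).
Proof.
move=> i1 i2; apply: eq_integrable; [exact: measurable01| |exact: (integrableD measurable01 i1 i2)].
by move=> t _ /=; rewrite EFinD.
Qed.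

Lemma integrable_extend01 (h : R -> R) : int01 h ->
  mu.-integrable setT (EFin \o (h \_ `[0, 1])).
Proof.
move=> ih; rewrite -restrict_EFin.
exact: ((@integrable_mkcond _ (measurableTypeR R) R mu _ (EFin \o h) measurable01).1 ih).
Qed.

Lemma extend01E (h : R -> R) t : 0 <= t <= 1 -> (h \_ `[0, 1]) t = h t.
Proof. by move=> t01; rewrite patchE mem_set//= in_itv. Qed.

(** This transfers absolute continuity from a nonpositive function to its
    exponential. *)
Lemma expR_lipschitz (a b : R) : a <= b -> b <= 0 -> expR b - expR a <= b - a.
Proof.
move=> ab b0.
have -> : expR b - expR a = expR b * (1 - expR (a - b)).
  by rewrite mulrBr mulr1 -expRD; congr (_ - expR _); ring.
have h1 : 1 - expR (a - b) <= b - a.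
  by have := expR_ge1Dx (a - b); move: (expR _) => E; lra.
have h0 : 0 <= 1 - expR (a - b) by rewrite subr_ge0 -expR0 ler_expR subr_le0.
apply: le_trans h1; rewrite -[leRHS]mul1r ler_wpM2r//.
by rewrite -expR0 ler_expR.
Qed.

(** The left-hand side is the real part of z times the conjugate of w. *)
Lemma re_inner_le (z w : R[i]) :
  complex.Re z * complex.Re w + complex.Im z * complex.Im w <= normc z * normc w.
Proof.
have -> : complex.Re z * complex.Re w + complex.Im z * complex.Im w =
    complex.Re (z * (complex.Re w +i* - complex.Im w)).
  by rewrite ReM/= mulrN opprK.
rewrite (le_trans (ler_norm _))// (le_trans (normc_Re _))//.
by rewrite normcM; case: w => a b /=; rewrite sqrrN.
Qed.

(** The energy y = |u|^2 + |v|^2 satisfies y' <= 2 K sg y almost everywhere, by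
    2 |u| |v| <= |u|^2 + |v|^2.  Its product with exp (-2 K int_0^t sg) is
    absolutely continuous with nonpositive derivative.  Squared moduli are used
    because the modulus itself is not differentiable at 0. *)
Lemma gronwall u v s1 s2 sg K x :
  0 <= K -> int01 sg -> (forall t, 0 <= sg t) ->
  (forall t, 0 <= t <= 1 -> normc (s1 t) <= K * sg t) ->
  (forall t, 0 <= t <= 1 -> normc (s2 t) <= K * sg t) ->
  abs_continuous01 u -> abs_continuous01 v ->
  {ae mu, forall t : R, 0 <= t <= 1 ->
     cderive_at u t (- (s1 t * v t)) /\ cderive_at v t (- (s2 t * u t))} ->
  0 <= x <= 1 ->
  normc (u x) ^+ 2 + normc (v x) ^+ 2 <=
  (normc (u 0) ^+ 2 + normc (v 0) ^+ 2) * expR (2 * K * I01 sg).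
Proof.
move=> K0 isg sg0 hs1 hs2 acu acv duv x01.
pose h := sg \_ `[0, 1].
have h0 t : 0 <= h t by rewrite /h patchE; case: ifP.
have ih := integrable_extend01 isg.
pose G t := \int[mu]_(r in `[0, t]) h r.
have G00 : G 0 = 0 by rewrite /G set_itv1 Rintegral_set1.
have acG : ac_real G by exact: ac_prim.
have GG a b : 0 <= a -> a <= b -> G a <= G b.
  by move=> a0 ab; rewrite -subr_ge0 prim_incr//; apply: Rintegral_ge0 => t _; exact: h0.
have G1 : G 1 = I01 sg.
  by apply: eq_Rintegral => t; rewrite inE/= in_itv/= => t01; rewrite /h extend01E.
pose y t := normc (u t) ^+ 2 + normc (v t) ^+ 2.
pose E t := expR (- (2 * K * G t)).
have yE : y = (fun t => (complex.Re (u t) * complex.Re (u t) + complex.Im (u t) * complex.Im (u t)) +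
   (complex.Re (v t) * complex.Re (v t) + complex.Im (v t) * complex.Im (v t))).
  by apply/funext => t; rewrite /y !normc_sqr !expr2.
have acE : ac_real E.
  have K20 : 0 <= 2 * K by rewrite mulr_ge0.
  apply: (@ac_incr_dom R (2 * K) 0 _ _ _ K20 (lexx 0) acG (@ac_incr_length R)).
  move=> a b a0 ab b1; rewrite mul0r addr0 distrC.
  have GK := ler_wpM2l K20 (GG _ _ a0 ab).
  rewrite ger0_norm; last by rewrite subr_ge0 ler_expR lerN2.
  rewrite (le_trans (expR_lipschitz _ _))//; [by rewrite lerN2|..].
    by rewrite oppr_le0 mulr_ge0// -G00 GG.
  have := ler_wpM2l K20 (ler_norm (G b - G a)); lra.
have acy : ac_real y.
  rewrite yE; have ac2 (f : R -> R) : ac_real f -> ac_real (fun t => f t * f t).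
    by move=> acf; exact: ac_realM.
  by do 2 apply: ac_realD; apply: ac2; (apply: ac_Re || apply: ac_Im).
have acyE : ac_real (fun t => y t * E t) by exact: ac_realM.
have key : y x * E x <= y 0 * E 0.
  have /ae_prim hG := ih.
  have negN : mu.-negligible (~` [set t : R | 0 <= t <= 1 ->
      exists2 l : R, is_derive t 1 (fun t => y t * E t) l & l <= 0]).
    apply: filterS2 duv hG => t duv hG t01.
    have [[dur dui] [dvr dvi]] := duv t01.
    have dG := hG (andP t01).1.
    have dE : is_derive t 1 E (expR (- (2 * K * G t)) * (- (2 * K * h t))).
      have dN : is_derive t 1 (- ((2 * K) *: G)) (- (2 * K * h t)).
        by apply: is_derive_eq.
      exact: (@is_derive1_comp R expR (fun t => - (2 * K * G t)) t _ _ _ dN).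
    pose p := - (s1 t * v t); pose q := - (s2 t * u t).
    have dy : is_derive t 1 y
        (2 * ((complex.Re (u t) * complex.Re p + complex.Im (u t) * complex.Im p) +
              (complex.Re (v t) * complex.Re q + complex.Im (v t) * complex.Im q))).
      rewrite yE (_ : (fun t => _) =
        ((fun t => complex.Re (u t)) * (fun t => complex.Re (u t)) +
         (fun t => complex.Im (u t)) * (fun t => complex.Im (u t))) +
        ((fun t => complex.Re (v t)) * (fun t => complex.Re (v t)) +
         (fun t => complex.Im (v t)) * (fun t => complex.Im (v t)))); last first.
        by apply/funext.
      apply: (is_derive_eq (is_deriveD (is_deriveD (is_deriveM dur dur) (is_deriveM dui dui))
        (is_deriveD (is_deriveM dvr dvr) (is_deriveM dvi dvi)))).
      rewrite /GRing.scale/= -/p -/q.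
      by move: (complex.Re p) (complex.Im p) (complex.Re q) (complex.Im q) => *; ring.
    have dyE := is_deriveM dy dE.
    rewrite (_ : (fun t => _) = y * E); last by apply/funext.
    eexists; first exact: dyE.
    rewrite /GRing.scale/= -/(E t).
    have hu := le_trans (re_inner_le (u t) p) (lexx _).
    have hv := le_trans (re_inner_le (v t) q) (lexx _).
    have np : normc p <= K * sg t * normc (v t).
      by rewrite /p normc_opp normcM; apply: ler_wpM2r; [exact: normc_nneg|exact: hs1].
    have nq : normc q <= K * sg t * normc (u t).
      by rewrite /q normc_opp normcM; apply: ler_wpM2r; [exact: normc_nneg|exact: hs2].
    have Et : 0 <= E t by exact: expR_ge0.
    rewrite [h t]extend01E//.
    move: hu hv np nq; rewrite /y.
    move: (_ + _ * complex.Im p) (_ + _ * complex.Im q) => P Q.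
    move: (normc_nneg (u t)) (normc_nneg (v t)) (normc_nneg p) (normc_nneg q) (sg0 t) Et.
    move: (normc p) (normc q) (normc (u t)) (normc (v t)) (sg t) (E t) => np nq a b s e a0 b0 np0 nq0 s0 e0.
    move=> hP hQ h1 h2.
    have {}h1 := ler_wpM2l a0 h1; have {}h2 := ler_wpM2l b0 h2.
    have Ks : 0 <= K * s by rewrite mulr_ge0.
    have sq : 0 <= K * s * (a - b) ^+ 2 by rewrite mulr_ge0// sqr_ge0.
    rewrite (_ : _ + e * _ = e * (2 * (P + Q) - 2 * K * s * (a ^+ 2 + b ^+ 2))); last by ring.
    by rewrite mulr_ge0_le0//; lra.
  apply: (ac_nonincreasing acyE negN _ x01) => t t01 /contrapT; exact.
have E0 : E 0 = 1 by rewrite /E G00 mulr0 oppr0 expR0.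
rewrite -/(y x) -/(y 0); move: key; rewrite E0 mulr1 /E => key.
have := ler_wpM2r (expR_ge0 (2 * K * G x)) key.
rewrite -[y x * _ * _]mulrA -expRD addNr expR0 mulr1 => /le_trans; apply.
rewrite ler_wpM2l ?addr_ge0 ?sqr_ge0// ler_expR -G1 ler_wpM2l ?mulr_ge0//.
by case/andP: x01 => x0 x1; exact: GG.
Qed.
End column.

(** * The off-diagonal system *)

Section column_bounds.
Context {R : realType}.
Notation mu := (@lebesgue_measure R).
Notation int01 h := (mu.-integrable `[0, 1]%classic (EFin \o h)).
Notation I01 h := (\int[mu]_(t in `[0, 1]) h t).

Lemma I01Z k (h : R -> R) : int01 h -> I01 (fun t => k * h t) = k * I01 h.
Proof. by move=> ih; rewrite RintegralZl//; exact: measurable01. Qed.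

Lemma I01D (h1 h2 : R -> R) : int01 h1 -> int01 h2 ->
  I01 (fun t => h1 t + h2 t) = I01 h1 + I01 h2.
Proof. by move=> i1 i2; rewrite RintegralD//; exact: measurable01. Qed.

Lemma I01_ge0 (h : R -> R) : (forall t, 0 <= h t) -> 0 <= I01 h.
Proof. by move=> h0; exact: Rintegral_ge0. Qed.

(** With M bounding u and v, the estimates of [column_bounds] have the
    nonnegative coefficients summed here, so this constant serves them all. *)
Definition column_cst (K A : R) : R :=
  let M := expR (K * A) in let c := 2 * K * M in
  let c1 := c * (1 + 2 * K * A) in
  M + c + c1 + 2 * K * c + 2 * K * c1 + 2 * K * A * c + 2 * K * A * (2 * K * c).

(** Here sg bounds the coefficients, S is the primitive of s2 and G bounds S;
    T is the second iterated integral of the system.  The point value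
    G x enters the estimates of v but not those of u: this is what keeps
    G x ^+ 2 out of the bound of v + S. *)
Lemma column_bounds (K : R) (u v s1 s2 S T : R -> R[i]) (sg G : R -> R) :
  0 <= K -> int01 sg -> (forall t, 0 <= sg t) -> (forall t, 0 <= G t) ->
  int01 (fun t => sg t * G t) -> int01 (fun t => sg t * G t ^+ 2) ->
  (forall t, 0 <= t <= 1 -> normc (s1 t) <= K * sg t) ->
  (forall t, 0 <= t <= 1 -> normc (s2 t) <= K * sg t) ->
  abs_continuous01 u -> abs_continuous01 v ->
  {ae mu, forall t : R, 0 <= t <= 1 ->
     cderive_at u t (- (s1 t * v t)) /\ cderive_at v t (- (s2 t * u t))} ->
  u 0 = 1 -> v 0 = 0 ->
  abs_continuous01 S -> S 0 = 0 ->
  {ae mu, forall t : R, 0 <= t <= 1 -> cderive_at S t (s2 t)} ->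
  (forall t, 0 <= t <= 1 -> normc (S t) <= G t) ->
  abs_continuous01 T -> T 0 = 0 ->
  {ae mu, forall t : R, 0 <= t <= 1 -> cderive_at T t (s1 t * S t)} ->
  let C := column_cst K (I01 sg) in
  let B := I01 (fun t => sg t * G t) in
  let B2 := I01 (fun t => sg t * G t ^+ 2) in
  forall x, 0 <= x <= 1 ->
  [/\ normc (u x) <= C, normc (v x) <= C,
      normc (u x - 1) <= C * B /\ normc (v x) <= C * (B + G x),
      normc (v x + S x) <= C * (G x * B + (B ^+ 2 + B2)) &
      normc (u x - 1 - T x) <= C * (B ^+ 2 + B2)].
Proof.
move=> K0 isg sg0 G0 isG isG2 hs1 hs2 acu acv duv u0 v0 acS S0 dS SG acT T0 dT C B B2.
set A := I01 sg.
pose M := expR (K * A); pose c := 2 * K * M; pose c1 := c * (1 + 2 * K * A).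
have A0 : 0 <= A by exact: I01_ge0.
have B0 : 0 <= B by apply: I01_ge0 => t; rewrite mulr_ge0.
have B20 : 0 <= B2 by apply: I01_ge0 => t; rewrite mulr_ge0// sqr_ge0.
have M0 : 0 <= M by exact: expR_ge0.
have KA0 : 0 <= 2 * K * A by rewrite !mulr_ge0.
have c0 : 0 <= c by rewrite !mulr_ge0.
have c10 : 0 <= c1 by rewrite mulr_ge0// addr_ge0.
have uvM x : 0 <= x <= 1 -> normc (u x) <= M /\ normc (v x) <= M.
  move=> x01; have := gronwall K0 isg sg0 hs1 hs2 acu acv duv x01.
  rewrite u0 v0 normc1 normc0 expr1n expr0n/= addr0 mul1r -/A -mulrA mulrDl mul1r.
  rewrite expRD -expr2 -/M => h; split;
    rewrite -(@ler_pXn2r _ 2) ?nnegrE ?normc_nneg//; apply: le_trans h.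
    by rewrite lerDl sqr_ge0.
  by rewrite lerDr sqr_ge0.
(* integration by parts: the product S u absorbs the term s2 u of v' *)
have dvSu : {ae mu, forall t : R, 0 <= t <= 1 ->
    cderive_at (fun t => v t + S t * u t) t (- (S t * s1 t * v t))}.
  apply: filterS2 duv dS => t duv dS t01; have [du dv] := duv t01.
  have := cderiveD dv (cderiveM (dS t01) du).
  by rewrite (_ : _ + _ = - (S t * s1 t * v t)); last by ring.
have acvSu : abs_continuous01 (fun t => v t + S t * u t) by apply: acD => //; exact: acM.
have vSu0 : v 0 + S 0 * u 0 = 0 by rewrite v0 S0 mul0r addr0.
have vbound x : 0 <= x <= 1 -> normc (v x) <= M * G x + c * B.
  move=> x01; have i1 := int01Z (K * M) isG.
  have := @ac_mean_value R _ (fun t => K * M * (sg t * G t)) x acvSu i1 _ _ x01.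
  rewrite vSu0 subr0 I01Z// -/B => H.
  have {}H : normc (v x + S x * u x) <= 2 * (K * M * B).
    apply: H => [t|]; first by rewrite !mulr_ge0.
    apply: filterS dvSu => t dvSu t01; eexists; first exact: dvSu.
    rewrite normc_opp !normcM.
    rewrite (_ : K * M * (sg t * G t) = G t * (K * sg t) * M); last by ring.
    apply: ler_pM; rewrite ?mulr_ge0 ?normc_nneg//; last exact: (uvM t t01).2.
    by apply: ler_pM; rewrite ?normc_nneg//; [exact: SG|exact: hs1].
  rewrite (_ : v x = (v x + S x * u x) - S x * u x); last by ring.
  rewrite (le_trans (normc_sub _ _))// addrC lerD//; last first.
    by rewrite (le_trans H)// /c; lra.
  rewrite normcM mulrC; apply: ler_pM; rewrite ?normc_nneg//; first exact: (uvM x x01).1.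
  exact: SG.
(* integrating against sg replaces the point value of G by B *)
have ubound x : 0 <= x <= 1 -> normc (u x - 1) <= c1 * B.
  move=> x01.
  have i1 : int01 (fun t => K * M * (sg t * G t) + K * c * B * sg t).
    by apply: int01D; exact: int01Z.
  have := @ac_mean_value R _ _ x acu i1 _ _ x01.
  rewrite u0 I01D ?I01Z//; [|exact: int01Z|exact: int01Z].
  rewrite -/A -/B => H; apply: le_trans (H _ _) _.
  - by move=> t; rewrite addr_ge0// !mulr_ge0.
  - apply: filterS duv => t duv t01; eexists; first exact: (duv t01).1.
    rewrite normc_opp normcM.
    rewrite [leRHS](_ : _ = (K * sg t) * (M * G t + c * B)); last by ring.
    by apply: ler_pM; rewrite ?normc_nneg//; [exact: hs1|exact: vbound].
  - by rewrite /c1 /c; lra.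
(* the derivative of v + S u again, now estimated with vbound; the remaining
   S (u - 1) is controlled by ubound *)
have wbound x : 0 <= x <= 1 ->
    normc (v x + S x) <= c1 * B * G x + (c * B2 + 2 * K * c * B ^+ 2).
  move=> x01.
  have i1 : int01 (fun t => K * M * (sg t * G t ^+ 2) + K * c * B * (sg t * G t)).
    by apply: int01D; exact: int01Z.
  have := @ac_mean_value R _ _ x acvSu i1 _ _ x01.
  rewrite vSu0 subr0 I01D ?I01Z//; [|exact: int01Z|exact: int01Z].
  rewrite -/B2 -/B => H.
  have {}H : normc (v x + S x * u x) <= c * B2 + 2 * K * c * B ^+ 2.
    apply: le_trans (H _ _) _.
    - by move=> t; rewrite addr_ge0// !mulr_ge0// ?sqr_ge0.
    - apply: filterS dvSu => t dvSu t01; eexists; first exact: dvSu.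
      rewrite normc_opp !normcM.
      rewrite [leRHS](_ : _ = G t * (K * sg t) * (M * G t + c * B)); last by ring.
      apply: ler_pM; rewrite ?mulr_ge0 ?normc_nneg//; last exact: vbound.
      by apply: ler_pM; rewrite ?normc_nneg//; [exact: SG|exact: hs1].
    - by rewrite /c; lra.
  rewrite (_ : v x + S x = (v x + S x * u x) - S x * (u x - 1)); last by ring.
  rewrite (le_trans (normc_sub _ _))// addrC lerD//.
  rewrite normcM mulrC; apply: ler_pM; rewrite ?normc_nneg//; first exact: ubound.
  exact: SG.
(* the derivative of u - T is - s1 (v + S) *)
have zbound x : 0 <= x <= 1 -> normc (u x - 1 - T x) <=
    2 * K * c1 * B ^+ 2 + 2 * K * A * (c * B2 + 2 * K * c * B ^+ 2).
  move=> x01.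
  have i1 : int01 (fun t => K * c1 * B * (sg t * G t) +
      K * (c * B2 + 2 * K * c * B ^+ 2) * sg t).
    by apply: int01D; exact: int01Z.
  have acz : abs_continuous01 (fun t => u t - T t) by apply: acD => //; exact: acN.
  have := @ac_mean_value R _ _ x acz i1 _ _ x01.
  rewrite u0 T0 subr0 I01D ?I01Z//; [|exact: int01Z|exact: int01Z].
  rewrite -/A -/B addrAC => H; apply: le_trans (H _ _) _.
  - move=> t; rewrite addr_ge0// ?mulr_ge0// addr_ge0// ?mulr_ge0// ?sqr_ge0//.
  - apply: filterS2 duv dT => t duv dT t01; eexists.
      exact: (cderiveD (duv t01).1 (cderiveN (dT t01))).
    rewrite (_ : _ - _ = - (s1 t * (v t + S t))); last by ring.
    rewrite normc_opp normcM.
    rewrite [leRHS](_ : _ = (K * sg t) * (c1 * B * G t + (c * B2 + 2 * K * c * B ^+ 2))); last by ring.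
    by apply: ler_pM; rewrite ?normc_nneg//; [exact: hs1|exact: wbound].
  - by rewrite le_eqVlt; apply/orP; left; apply/eqP; ring.
have CE : C = M + c + c1 + 2 * K * c + 2 * K * c1 + 2 * K * A * c + 2 * K * A * (2 * K * c).
  by [].
have K20 : 0 <= 2 * K by rewrite mulr_ge0.
have p1 : 0 <= 2 * K * c by exact: mulr_ge0.
have p2 : 0 <= 2 * K * c1 by exact: mulr_ge0.
have p3 : 0 <= 2 * K * A * c by exact: mulr_ge0.
have p4 : 0 <= 2 * K * A * (2 * K * c) by exact: mulr_ge0.
move=> x x01; have Gx0 := G0 x.
have [um vm] := uvM x x01.
have MC : M <= C by rewrite CE; lra.
have cle k y z : 0 <= y -> z <= k * y -> k <= C -> z <= C * y.
  by move=> y0 zk kC; rewrite (le_trans zk)// ler_wpM2r.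
have BG : 0 <= B * G x by rewrite mulr_ge0.
have B22 : 0 <= B ^+ 2 by rewrite sqr_ge0.
split.
- exact: le_trans um MC.
- exact: le_trans vm MC.
- split; first by apply: cle (ubound x x01) _ => //; rewrite CE; lra.
  apply: (cle (M + c)); [by rewrite addr_ge0| |by rewrite CE; lra].
  rewrite (le_trans (vbound x x01))//.
  have := mulr_ge0 M0 B0; have := mulr_ge0 c0 Gx0; lra.
- rewrite (mulrC (G x)).
  apply: (cle (c1 + c + 2 * K * c)); [by rewrite !addr_ge0| |by rewrite CE; lra].
  rewrite (le_trans (wbound x x01))//.
  have := mulr_ge0 c10 B22; have := mulr_ge0 c0 B22; have := mulr_ge0 p1 B20.
  have := mulr_ge0 c10 B20; have := mulr_ge0 c0 BG; have := mulr_ge0 p1 BG; lra.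
- apply: (cle (2 * K * c1 + 2 * K * A * c + 2 * K * A * (2 * K * c)));
    [by rewrite !addr_ge0| |by rewrite CE; lra].
  rewrite (le_trans (zbound x x01))//.
  have := mulr_ge0 p2 B20; have := mulr_ge0 p3 B22; have := mulr_ge0 p4 B20; lra.
Qed.

End column_bounds.

(** * The exponential of x A *)

Section complex_exponential.
Context {R : realType}.
Implicit Types (z w : R[i]) (x t : R).
Notation mu := (@lebesgue_measure R).

Lemma cexp0 : cexp (0 : R[i]) = 1.
Proof. by rewrite /cexp /= expR0 cos0 sin0 mulr1 mulr0. Qed.

Lemma cexpD z w : cexp (z + w) = cexp z * cexp w.
Proof.
apply: complex_eq; rewrite ?ReM ?ImM /cexp/= ReD ImD expRD ?cosD ?sinD; ring.
Qed.

Lemma normc_cexp z : normc (cexp z) = expR (complex.Re z).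
Proof.
rewrite /cexp /= !exprMn -mulrDr cos2Dsin2 mulr1 sqrtr_sqr ger0_norm// expR_ge0.
Qed.

Lemma cexpNM z : cexp (- z) * cexp z = 1.
Proof. by rewrite -cexpD addNr cexp0. Qed.

Lemma cderive_id x : cderive_at (fun t => t%:C) x 1.
Proof. by split => /=; [exact: is_derive_id|exact: is_derive_cst]. Qed.

Lemma cderive_linear z x : cderive_at (fun t => z * t%:C) x z.
Proof.
have := cderiveM (cderive_cst z x) (cderive_id x).
by rewrite mul0r add0r mulr1.
Qed.

Lemma cderive_cexp z x :
  cderive_at (fun t => cexp (z * t%:C)) x (z * cexp (z * x%:C)).
Proof.
have [h1 h2] := cderive_linear z x.
have he := @is_derive1_comp R expR _ x _ _ (is_derive_expR _) h1.
have hc := @is_derive1_comp R cos _ x _ _ (is_derive_cos _) h2.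
have hs := @is_derive1_comp R sin _ x _ _ (is_derive_sin _) h2.
split; rewrite ?ReM ?ImM /cexp/=.
  apply: (is_derive_eq (is_deriveM he hc)); rewrite /GRing.scale/=; ring.
apply: (is_derive_eq (is_deriveM he hs)); rewrite /GRing.scale/=; ring.
Qed.

Lemma lipschitz_of_derive (f df : R -> R) M a b :
  (forall x, is_derive x 1 f (df x)) -> (forall x, 0 <= x <= 1 -> `|df x| <= M) ->
  0 <= a -> a <= b -> b <= 1 -> `|f b - f a| <= M * (b - a).
Proof.
move=> hf hM a0 ab b1.
have [|c cab ->] := MVT_segment ab (fun x _ => hf x).
  apply: derivable_within_continuous => x _; exact: ex_derive.
rewrite normrM (@ger0_norm _ (b - a)) ?subr_ge0// ler_wpM2r ?subr_ge0// hM//.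
by move: cab; rewrite in_itv/= => /andP[ac cb]; rewrite (le_trans a0 ac) (le_trans cb b1).
Qed.

Lemma ac_C1 (f df : R -> R[i]) M :
  (forall x, cderive_at f x (df x)) -> (forall x, 0 <= x <= 1 -> normc (df x) <= M) ->
  abs_continuous01 f.
Proof.
move=> hf hM; have M0 : 0 <= M by apply: le_trans (normc_nneg _) (hM 0 _); rewrite lexx ler01.
apply: ac_ReIm.
  apply: (@ac_incr_dom R M 0 _ _ _ M0 (lexx 0) (@ac_incr_length R) (@ac_incr_length R)).
  move=> a b a0 ab b1; rewrite mul0r addr0.
  apply: lipschitz_of_derive (fun x => (hf x).1) _ a0 ab b1 => x x01.
  exact: le_trans (normc_Re _) (hM x x01).
apply: (@ac_incr_dom R M 0 _ _ _ M0 (lexx 0) (@ac_incr_length R) (@ac_incr_length R)).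
move=> a b a0 ab b1; rewrite mul0r addr0.
apply: lipschitz_of_derive (fun x => (hf x).2) _ a0 ab b1 => x x01.
exact: le_trans (normc_Im _) (hM x x01).
Qed.

Lemma Re_mul_real_le z x : 0 <= x <= 1 -> complex.Re (z * x%:C) <= `|complex.Re z|.
Proof.
move=> /andP[x0 x1]; rewrite ReM/= mulr0 subr0 (le_trans (ler_norm _))// normrM.
by rewrite (ger0_norm x0) ler_piMr.
Qed.

Lemma normc_cexp_le z x : 0 <= x <= 1 ->
  normc (cexp (z * x%:C)) <= expR `|complex.Re z|.
Proof. by move=> x01; rewrite normc_cexp ler_expR Re_mul_real_le. Qed.

Lemma ac_cexp z : abs_continuous01 (fun t => cexp (z * t%:C)).
Proof.
apply: (ac_C1 (cderive_cexp z)) => x x01; rewrite normcM.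
apply: ler_wpM2l (normc_cexp_le z x01); exact: normc_nneg.
Qed.

Definition exp_term z (n : nat) : R[i] := (n`!%:R)^-1 * z ^+ n.

Lemma exp_termS z n : exp_term z n.+1 = n.+1%:R^-1 * z * exp_term z n.
Proof. by rewrite /exp_term factS natrM invfM exprS; ring. Qed.

Lemma cderive_exp_term z n x :
  cderive_at (fun t => exp_term (z * t%:C) n.+1) x (z * exp_term (z * x%:C) n).
Proof.
elim: n => [|n ih].
  rewrite (_ : (fun t => _) = (fun t => z * t%:C)); last first.
    by apply/funext => t; rewrite exp_termS /exp_term fact0 invr1 !mul1r expr0 mulr1.
  rewrite /exp_term fact0 invr1 expr0 !mulr1; exact: cderive_linear.
rewrite (_ : (fun t => _) = (fun t => (n.+2%:R^-1 * (z * t%:C)) * exp_term (z * t%:C) n.+1)); last first.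
  by apply/funext => t; rewrite exp_termS.
have := cderiveM (cderiveM (cderive_cst (n.+2%:R^-1) x) (cderive_linear z x)) ih.
rewrite mul0r add0r.
suff -> : n.+2%:R^-1 * z * exp_term (z * x%:C) n.+1 +
    n.+2%:R^-1 * (z * x%:C) * (z * exp_term (z * x%:C) n) =
    z * exp_term (z * x%:C) n.+1 by [].
have nz k : k.+1%:R != 0 :> R[i] by rewrite pnatr_eq0.
have a0 := nz n; have a1 := nz n.+1; move: a0 a1.
rewrite exp_termS -[n.+2]addn1 natrD; move: (n.+1%:R : R[i]) => a a0 a1.
by field; rewrite a0 a1.
Qed.

Lemma cderive_exp_sum z n x :
  cderive_at (fun t => \sum_(k < n.+1) exp_term (z * t%:C) k) x
    (z * \sum_(k < n) exp_term (z * x%:C) k).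
Proof.
elim: n => [|n ih].
  rewrite big_ord0 mulr0 (_ : (fun t => _) = (fun=> 1)); first exact: cderive_cst.
  by apply/funext => t; rewrite big_ord1 /exp_term fact0 invr1 expr0 mulr1.
rewrite [X in _ * X]big_ord_recr/= mulrDr.
rewrite (_ : (fun t => _) = (fun t => \sum_(k < n.+1) exp_term (z * t%:C) k + exp_term (z * t%:C) n.+1)).
  exact: cderiveD ih (cderive_exp_term _ _ _).
by apply/funext => t; rewrite big_ord_recr.
Qed.

Lemma normcX z n : normc (z ^+ n) = normc z ^+ n.
Proof. by elim: n => [|n ih]; rewrite ?expr0 ?normc1// !exprS normcM ih. Qed.

Lemma normc_nat n : normc (n%:R : R[i]) = n%:R.
Proof.
have -> : (n%:R : R[i]) = (n%:R)%:C by rewrite rmorph_nat.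
by rewrite /= expr0n/= addr0 sqrtr_sqr ger0_norm.
Qed.

Lemma int01_cst (M : R) : mu.-integrable `[0, 1]%classic (EFin \o (fun=> M)).
Proof.
apply/integrableP; split; first exact/measurable_EFinP/measurable_cst.
rewrite /comp/= (integral_cst _ measurable01).
by rewrite /= lebesgue_measure_itv/= lte_fin ltr01/= -EFinD -EFinM ltry.
Qed.

(** The partial sum of order n at z t, multiplied by e^{-zt}, equals 1 at t = 0,
    and its derivative in t reduces to a multiple of the term of order n.  The mean
    value inequality on [0, 1] therefore bounds its distance to 1 at t = 1, with
    factorial decay in n. *)
Lemma exp_sum_error z n :
  normc (\sum_(k < n.+1) exp_term z k - cexp z) <=
  normc (cexp z) * (2 * (expR `|complex.Re z| * normc z)) * exp_coeff (normc z) n.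
Proof.
pose P t := \sum_(k < n.+1) exp_term (z * t%:C) k.
pose E t := cexp (- z * t%:C).
have dh x : cderive_at (fun t => E t * P t) x (- (E x * (z * exp_term (z * x%:C) n))).
  have := cderiveM (cderive_cexp (- z) x) (cderive_exp_sum z n x).
  by rewrite big_ord_recr/= /E; set A := (\sum_(i < n) _); rewrite (_ : _ + _ = - (cexp (- z * x%:C) * (z * exp_term (z * x%:C) n))); last by ring.
pose M := expR `|complex.Re z| * normc z * exp_coeff (normc z) n.
have hM x : 0 <= x <= 1 -> normc (- (E x * (z * exp_term (z * x%:C) n))) <= M.
  move=> x01; rewrite normc_opp !normcM /M -mulrA; apply: ler_pM; rewrite ?mulr_ge0 ?normc_nneg//.
    by rewrite (le_trans (normc_cexp_le _ x01))// ReN normrN.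
  apply: ler_wpM2l; first exact: normc_nneg.
  rewrite /exp_coeff/= normcV normc_nat normcX normcM mulrC ler_wpM2r ?invr_ge0//.
  rewrite lerXn2r ?nnegrE ?mulr_ge0 ?normc_nneg//.
  case/andP: x01 => x0 x1; rewrite (_ : normc x%:C = x); first by rewrite ler_piMr ?normc_nneg.
  by rewrite /= expr0n/= addr0 sqrtr_sqr ger0_norm.
have iM := int01_cst M.
have x01 : (0 : R) <= (1 : R) <= 1 by rewrite ler01 lexx.
have M0 : 0 <= M := le_trans (normc_nneg _) (hM 1 x01).
have := @ac_mean_value R _ (fun=> M) 1 (ac_C1 dh hM) iM (fun=> M0) _ x01.
rewrite Rintegral_cst; last exact: measurable01.
have -> : fine (mu `[0%R, 1%R]%classic) = 1 by rewrite lebesgue_measure_itv/= lte_fin ltr01/= oppr0 addr0.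
rewrite mulr1 => H.
have {}H : normc (E 1 * P 1 - E 0 * P 0) <= 2 * M.
  by apply: H; apply: nearW => t t01; eexists; [exact: dh|exact: hM].
have P0 : P 0 = 1.
  rewrite /P big_ord_recl big1 ?addr0; last first.
    by move=> i _; rewrite /exp_term mulr0 expr0n/= mulr0.
  by rewrite /exp_term fact0 invr1 expr0 mulr1.
move: H; rewrite P0 /E /P mulr0 cexp0 !mulr1.
set Q := (\sum_(k < n.+1) exp_term z k) => H.
have -> : Q - cexp z = cexp z * (cexp (- z) * Q - 1).
  by rewrite mulrBr mulr1 mulrA [cexp z * _]mulrC cexpNM mul1r.
rewrite normcM -mulrA; apply: ler_wpM2l; first exact: normc_nneg.
by rewrite (le_trans H)// /M; lra.
Qed.

Lemma exp_sum_cvg z :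
  clim (fun n => \sum_(k < n) exp_term z k) = cexp z.
Proof.
pose c := normc (cexp z) * (2 * (expR `|complex.Re z| * normc z)).
have c0 : (fun n => c * exp_coeff (normc z) n) @ \oo --> (0 : R).
  rewrite -(mulr0 c); apply: cvgMr; apply: cvg_series_cvg_0; exact: is_cvg_series_exp_coeff.
have H (p : R[i] -> R) : (forall w, `|p w| <= normc w) -> {morph p : x y / x - y} ->
    (fun n => p (\sum_(k < n) exp_term z k)) @ \oo --> p (cexp z).
  move=> hp pB; rewrite -(cvg_shiftn 1)/=; apply/cvgrPdist_le => e e0.
  move/cvgrPdist_le : c0 => /(_ _ e0); apply: filterS => n.
  rewrite sub0r normrN => h; rewrite -pB (le_trans (hp _))// -normc_opp opprB addn1.
  by rewrite (le_trans (exp_sum_error z n))// (le_trans (ler_norm _)).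
rewrite /clim; apply: complex_eq => /=; apply: cvg_lim => //; apply: H.
- exact: normc_Re.
- by move=> a b; rewrite ReD ReN.
- exact: normc_Im.
- by move=> a b; rewrite ImD ImN.
Qed.

(** The powers of a diagonal matrix are diagonal, so the series defining the
    exponential splits into two scalar series. *)
Lemma expxAE (m : R[i]) x : expxA m x =
  \matrix_(i, j) (if i == j then
    (if i == ord0 then cexp ('i%C * m * x%:C) else cexp (- ('i%C * m * x%:C))) else 0).
Proof.
pose w (i : 'I_2) := if i == ord0 then 'i%C * m * x%:C else - ('i%C * m * x%:C).
have AE : x%:C *: Amu m = \matrix_(i, j) (if i == j then w i else 0).
  apply/matrixP => i j; rewrite !mxE /w; case: ifP => _; last by rewrite !mulr0.
  by case: ifP => _; ring.
have AX k : (x%:C *: Amu m) ^+ k = \matrix_(i, j) (if i == j then w i ^+ k else 0).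
  elim: k => [|k ih].
    by apply/matrixP => i j; rewrite !mxE; case: eqP.
  apply/matrixP => i j; rewrite exprS ih AE !mxE (bigD1 i)//= !mxE eqxx big1 ?addr0.
    by case: ifP => _; rewrite ?mulr0// exprS.
  by move=> l li; rewrite !mxE eq_sym (negPf li) mul0r.
apply/matrixP => i j; rewrite !mxE.
rewrite (_ : (fun n => _) = (fun n => \sum_(k < n) if i == j then exp_term (w i) k else 0)); last first.
  apply/funext => n; rewrite summxE; apply: eq_bigr => k _; rewrite AX !mxE /exp_term.
  by case: ifP; rewrite ?mulr0.
case: ifP => _; first by rewrite exp_sum_cvg /w; case: ifP.
under eq_fun do rewrite big1_eq.
by rewrite /clim /= !lim_cst.
Qed.

End complex_exponential.

(** * Hoelder's inequality on the unit interval *)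

Section hoelder01.
Context {R : realType}.
Implicit Types (f g : R -> R[i]) (p : R).
Notation mu := (@lebesgue_measure R).
Notation int01 h := (mu.-integrable `[0, 1]%classic (EFin \o h)).
Notation I01 h := (\int[mu]_(t in `[0, 1]) h t).
Local Notation mT := (measurableTypeR R).
Local Notation D01 := (`[0%R : R, 1%R]%classic : set mT).

Definition cmeasurable01 f :=
  measurable_fun D01 (fun t => complex.Re (f t)) /\
  measurable_fun D01 (fun t => complex.Im (f t)).

Definition normc01 f : mT -> R := (fun t => normc (f t)) \_ `[0, 1].

Lemma normc01_ge0 f t : 0 <= normc01 f t.
Proof. by rewrite /normc01 patchE; case: ifP => // _; exact: normc_nneg. Qed.

Lemma measurable_normc f : cmeasurable01 f ->
  measurable_fun D01 (fun t => normc (f t)).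
Proof.
move=> [mr mi].
rewrite (_ : (fun t => _) = (fun t => Num.sqrt (complex.Re (f t) ^+ 2 + complex.Im (f t) ^+ 2))); last first.
  by apply/funext => t; case: (f t).
apply: (@measurableT_comp _ _ _ _ _ _ (@Num.sqrt R)).
  apply: continuous_measurable_fun; exact: sqrt_continuous.
by apply: measurable_funD; exact: measurable_funX.
Qed.

Lemma measurable_normc01 f : cmeasurable01 f -> measurable_fun setT (normc01 f).
Proof.
move=> mf; apply/(measurable_restrictT _ _).1; first exact: measurable01.
exact: measurable_normc.
Qed.

(** On [0, 1], the inequality |f| <= 1 + |f|^p gives integrability. *)
Lemma Lp_int01 p f : 1 <= p -> in_Lp p%:E f -> int01 (fun t => normc (f t)).
Proof.
move=> p1 [mr mi fin].
have mf : cmeasurable01 f by [].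
have mn := measurable_normc01 mf.
have Lf : normc01 f \in Lfun mu p%:E.
  by rewrite inE; apply/andP; split; rewrite inE.
have := Lfun_integrable p1 Lf.
move=> /(integrableS measurableT measurable01 (@subsetT _ _)) ip.
apply: (le_integrable measurable01 _ _ (int01D (int01_cst 1) ip)).
  by apply/measurable_EFinP; exact: (measurable_normc mf).
move=> t; rewrite /= in_itv/= => t01; rewrite lee_fin.
rewrite ger0_norm ?normc_nneg// ger0_norm ?addr_ge0 ?powR_ge0//.
rewrite (ger0_norm (normc01_ge0 f t)) /normc01 extend01E//.
have [n1|n1] := leP (normc (f t)) 1; first by rewrite (le_trans n1)// lerDl powR_ge0.
rewrite (@le_trans _ _ (normc (f t) `^ p))//; last by rewrite lerDr.
by rewrite -[leLHS]powRr1 ?normc_nneg// ler_powR// ltW.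
Qed.

Lemma I01_normc01 f g : \int[mu]_(t in `[0, 1]) (normc (f t) * normc (g t)) =
  fine (\int[mu]_t (normc01 f t * normc01 g t)%:E).
Proof.
rewrite Rintegral_mkcond /Rintegral; congr fine; apply: eq_integral => t _.
by rewrite /normc01 !patchE; case: ifP => //; rewrite mulr0.
Qed.

Lemma Lpnorm_ge0 (q : \bar R) f : 0 <= Lpnorm q f.
Proof. by rewrite /Lpnorm fine_ge0// Lnorm_ge0. Qed.

Lemma Lpnorm1E f : Lpnorm 1%E f = I01 (fun t => normc (f t)).
Proof.
rewrite /Lpnorm /eLpnorm Lnorm1 Rintegral_mkcond /Rintegral; congr fine.
apply: eq_integral => t _; rewrite /= ger0_norm//; exact: normc01_ge0.
Qed.

(** The real number [Lpnorm] carries information only when the extended norm is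
    finite; boundedness ensures this for every exponent. *)
Lemma eLpnorm_bounded_lty (q : \bar R) f M : (1 <= q)%E -> cmeasurable01 f ->
  (forall t, 0 <= t <= 1 -> normc (f t) <= M) -> (eLpnorm q f < +oo)%E.
Proof.
move=> q1 mf fM.
have M0 : 0 <= M by apply: le_trans (normc_nneg _) (fM 0 _); rewrite lexx ler01.
have nM t : normc01 f t <= M.
  rewrite /normc01 patchE; case: ifPn => // /set_mem; rewrite /= in_itv/=; exact: fM.
case: q q1 => [q + |_|//]; rewrite /eLpnorm unlock; first rewrite lee_fin => q1.
  apply: poweR_lty.
  apply: (@le_lt_trans _ _ (\int[mu]_(t in D01) (M `^ q)%:E)%E).
    rewrite [leRHS]integral_mkcond; apply: ge0_le_integral => //=.
    - apply/measurable_EFinP.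
      apply: (measurableT_comp (measurable_powR _)).
      by apply: measurableT_comp => //; exact: measurable_normc01.
    - by apply/(measurable_restrictT _ _).1; [exact: measurable01|exact: measurable_cst].
    - move=> t _; have q0 : 0 <= q by exact: (le_trans ler01).
      rewrite [leRHS]patchE; case: ifPn => t01 /=; rewrite lee_fin.
        by rewrite ge0_ler_powR ?nnegrE// ger0_norm ?normc01_ge0//; exact: nM.
      rewrite /normc01 patchE (negbTE t01) normr0 powR0//.
      by rewrite gt_eqF// (lt_le_trans _ q1).
  rewrite (integral_cst _ measurable01)/= lebesgue_measure_itv/= lte_fin ltr01/=.
  by rewrite -EFinD -EFinM ltry.
case: ifP => // _.
apply: (@le_lt_trans _ _ M%:E); last by rewrite ltry.
apply/ess_supP; apply: nearW => t /=; rewrite lee_fin ger0_norm; first exact: nM.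
exact: normc01_ge0.
Qed.

Lemma lebesgue_setT_gt0 : (0 < mu [set: mT])%E.
Proof.
apply: (@lt_le_trans _ _ (mu D01)).
  by rewrite /= lebesgue_measure_itv/= lte_fin ltr01/= -EFinD lte_fin subr0 ltr01.
by apply: le_measure; rewrite ?inE//; exact: measurable01.
Qed.

(** For p = 1 the conjugate exponent is infinite and the second norm is an
    essential supremum, which dominates g almost everywhere; for p > 1 both
    exponents are finite. *)
Lemma hoelder01 p f g M : 1 <= p -> in_Lp p%:E f -> cmeasurable01 g ->
  (forall t, 0 <= t <= 1 -> normc (g t) <= M) ->
  I01 (fun t => normc (f t) * normc (g t)) <=
  Lpnorm p%:E f * Lpnorm (hoelder_conjugate p%:E) g.
Proof.
move=> p1 Lf mg gM; have [mr mi fin] := Lf.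
have mF : measurable_fun setT (normc01 f) by exact: measurable_normc01.
have mG : measurable_fun setT (normc01 g) by exact: measurable_normc01.
have q1 : (1 <= hoelder_conjugate p%:E)%E by rewrite hoelder_conj_ge1.
have fing := eLpnorm_bounded_lty q1 mg gM.
have FGge0 t : (0 <= (normc01 f t * normc01 g t)%:E)%E.
  by rewrite lee_fin mulr_ge0 ?normc01_ge0.
suff H : (\int[mu]_t (normc01 f t * normc01 g t)%:E <=
    eLpnorm p%:E f * eLpnorm (hoelder_conjugate p%:E) g)%E.
  have ff : eLpnorm p%:E f \is a fin_num by rewrite ge0_fin_numE// Lnorm_ge0.
  have fg : eLpnorm (hoelder_conjugate p%:E) g \is a fin_num.
    by rewrite ge0_fin_numE// Lnorm_ge0.
  rewrite I01_normc01 /Lpnorm -fineM// fine_le//; last by rewrite fin_numM.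
  rewrite ge0_fin_numE; last exact: integral_ge0.
  by rewrite (le_lt_trans H)// -ge0_fin_numE ?mule_ge0 ?Lnorm_ge0// fin_numM.
move: p1; rewrite le_eqVlt => /predU1P[p1|p1].
  rewrite -p1 hoelder_conjugate1 /eLpnorm Lnorm1 -/(normc01 f) -/(normc01 g) unlock.
  rewrite lebesgue_setT_gt0.
  set e := ess_sup _ _.
  have e0 : (0 <= e)%E.
    by apply: ess_sup_gee; [exact: lebesgue_setT_gt0|apply: nearW => t /=; rewrite lee_fin].
  rewrite muleC.
  have efin : e \is a fin_num.
    move: fing; rewrite -p1 hoelder_conjugate1 /eLpnorm -/(normc01 g) unlock.
    rewrite lebesgue_setT_gt0.
    by rewrite -/e ge0_fin_numE.
  rewrite -(fineK efin) -ge0_integralZl//=; last 2 first.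
  - by apply/measurable_EFinP; apply: measurableT_comp.
  - by rewrite lee_fin fine_ge0.
  apply: ae_ge0_le_integral => //=.
  - exact/measurable_EFinP/measurable_funM.
  - by move=> t _; rewrite mule_ge0// ?lee_fin ?fine_ge0.
  - apply/measurable_EFinP; apply: measurable_funM => //; exact: measurableT_comp.
  have := ess_sup_ge mu (abse \o (EFin \o normc01 g)); rewrite -/e.
  apply: filterS => t /=; rewrite -[in X in X -> _](fineK efin) lee_fin => h _.
  rewrite -EFinM lee_fin mulrC; apply: ler_pM; rewrite ?normc01_ge0//.
  - exact: le_trans (ler_norm _) h.
  - exact: ler_norm.
have p0 : 0 < p by exact: lt_trans p1.
have qE : hoelder_conjugate p%:E = (p / (p - 1))%:E.
  by rewrite /hoelder_conjugate/= gt_eqF// inver subr_eq0 gt_eqF.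
rewrite qE.
have := @hoelder _ _ _ mu (normc01 f) (normc01 g) p (p / (p - 1)) mF mG p0.
rewrite Lnorm1 => H.
apply: le_trans (H _ _).
- apply: ge0_le_integral => //.
  + exact/measurable_EFinP/measurable_funM.
  + by apply: measurableT_comp => //; exact/measurable_EFinP/measurable_funM.
  + by move=> t _; rewrite /= lee_fin ler_norm.
- by rewrite divr_gt0// subr_gt0.
- by rewrite invfM invrK; field; rewrite gt_eqF.
Qed.
End hoelder01.

(** * Translations and Fubini's theorem *)

Section translation.
Context {R : realType}.
Notation mu := (@lebesgue_measure R).
Local Notation mT := (measurableTypeR R).

Definition shift_by (c : R) : mT -> mT := fun t => t + c.

Lemma measurable_shift_by c : measurable_fun setT (shift_by c).
Proof. by apply: measurable_funD => //; exact: measurable_cst. Qed.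

Lemma shift_by_itv c (b0 b1 : bool) (a b : R) :
  shift_by c @^-1` [set` Interval (BSide b0 a) (BSide b1 b)] =
  [set` Interval (BSide b0 (a - c)) (BSide b1 (b - c))].
Proof.
apply/seteqP; split => t; rewrite /= /shift_by !in_itv/=;
  case: b0; case: b1 => /=; rewrite ?(lerBlDr, lerBrDr, ltrBlDr, ltrBrDr)//.
Qed.

Lemma lebesgue_measure_shift c (A : set mT) : measurable A ->
  pushforward mu (shift_by c) A = mu A.
Proof.
move=> mA; have mS := measurable_shift_by c.
apply/esym/lebesgue_measure_unique => //= _ [[a b]] _ <-.
rewrite /pushforward shift_by_itv/= !lebesgue_measure_itv/=.
by rewrite !lte_fin ltrD2r !EFinB; case: ifP => // _; rewrite -!EFinB; congr EFin; ring.
Qed.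

Lemma ge0_integral_shift (c : R) (f : mT -> \bar R) : measurable_fun setT f ->
  (forall t, 0 <= f t)%E -> (\int[mu]_t f (t + c)%R = \int[mu]_t f t)%E.
Proof.
move=> mf f0; have mS := measurable_shift_by c.
transitivity (\int[pushforward mu (shift_by c)]_t f t)%E.
  by rewrite ge0_integral_pushforward// preimage_setT.
by apply: eq_measure_integral => A mA _; exact: lebesgue_measure_shift.
Qed.

Lemma Rintegral_shift (c : R) (f : R -> R) (a b : R) :
  mu.-integrable setT (EFin \o f) ->
  \int[mu]_(t in `[a - c, b - c]) f (t + c) = \int[mu]_(t in `[a, b]) f t.
Proof.
move=> intf; have mS := measurable_shift_by c.
rewrite /Rintegral; congr fine.
have mf : measurable_fun setT (EFin \o f) := measurable_int mu intf.
have intS : mu.-integrable setT ((EFin \o f) \o shift_by c).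
  apply/integrableP; split; first exact: (measurableT_comp mf mS).
  have /integrableP[_] := intf.
  by rewrite -(@ge0_integral_shift c)//; exact: measurableT_comp.
have mI : measurable (`[a, b]%classic : set mT) by exact: measurable_itv.
transitivity (\int[pushforward mu (shift_by c)]_(t in `[a, b]) (EFin \o f) t)%E; last first.
  by apply: eq_measure_integral => A mA _; exact: lebesgue_measure_shift.
rewrite integral_pushforward//; first by rewrite shift_by_itv.
apply: (integrableS measurableT _ (@subsetT _ _) intS).
by rewrite -[X in measurable X]setTI; exact: mS.
Qed.

End translation.

Section weighted_fubini.
Context {R : realType}.
Notation mu := (@lebesgue_measure R).
Local Notation mT := (measurableTypeR R).
Implicit Types k : mT * mT -> R.
Notation int2 k := ((mu \x mu)%E.-integrable setT (EFin \o k)).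

(** Real-valued integrals replace infinite values by 0; this does no harm in an
    outer integral when the inner one is finite almost everywhere. *)
Lemma ae_Rintegral (F : mT -> \bar R) : measurable_fun setT F ->
  {ae mu, forall t, F t \is a fin_num} ->
  \int[mu]_t fine (F t) = fine (\int[mu]_t F t)%E.
Proof.
move=> mF finF; congr fine; apply: ae_eq_integral => //.
  by apply/measurable_EFinP; apply: (measurableT_comp (fine_measurable measurableT)).
by apply: filterS finF => t h _; rewrite fineK.
Qed.

Lemma Rfubini k : int2 k ->
  \int[mu]_t \int[mu]_r k (t, r) = \int[mu]_r \int[mu]_t k (t, r).
Proof.
move=> ik; have h1 := ae_integrable1 ik; have h2 := ae_integrable2 ik.
rewrite [LHS](ae_Rintegral (measurable_fubini_F ik)); last first.
  by apply: filterS h1 => t h; exact: integrable_fin_num.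
rewrite [RHS](ae_Rintegral (measurable_fubini_G ik)); last first.
  by apply: filterS h2 => t h; exact: integrable_fin_num.
by congr fine; exact: Fubini.
Qed.

(** The weights enter the inner integrals by linearity only at those t where
    k1 (t, r) and k2 (t, r) are integrable in r, that is, almost everywhere.
    Two kernels and two weights are what the real part of a product of complex
    functions requires. *)
Lemma Rfubini_weighted k1 k2 (e1 e2 : mT -> R) (M : R) :
  int2 k1 -> int2 k2 -> measurable_fun setT e1 -> measurable_fun setT e2 ->
  (forall t, `|e1 t| <= M) -> (forall t, `|e2 t| <= M) ->
  \int[mu]_t (e1 t * (\int[mu]_r k1 (t, r)) - e2 t * (\int[mu]_r k2 (t, r))) =
  \int[mu]_r \int[mu]_t (e1 t * k1 (t, r) - e2 t * k2 (t, r)).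
Proof.
move=> ik1 ik2 me1 me2 e1M e2M.
have iek k (e : mT -> R) : int2 k -> measurable_fun setT e -> (forall t, `|e t| <= M) ->
    int2 (fun z => e z.1 * k z).
  move=> ik me eM.
  have me' : measurable_fun setT (fun z : mT * mT => e z.1).
    exact: measurableT_comp.
  apply: (@le_integrable _ _ _ _ _ measurableT _ (fun z => (M * k z)%:E)).
  - apply/measurable_EFinP; apply: measurable_funM => //.
    by apply/measurable_EFinP; exact: measurable_int ik.
  - move=> z _; rewrite lee_fin !normrM ler_wpM2r// (le_trans (eM _))// ler_norm//.
  - have := integrableZl measurableT M ik.
    by apply: eq_integrable => // z _; rewrite EFinM.
have i1 := iek _ _ ik1 me1 e1M; have i2 := iek _ _ ik2 me2 e2M.
have i12 : int2 (fun z => e1 z.1 * k1 z - e2 z.1 * k2 z).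
  have := integrableB measurableT i1 i2.
  by apply: eq_integrable => // z _; rewrite /= EFinB.
rewrite -(Rfubini i12)/= /Rintegral; congr fine.
have mF k : int2 k -> measurable_fun setT (fun t : mT => fine (\int[mu]_r (k (t, r))%:E)).
  move=> ik; apply: (measurableT_comp (fine_measurable measurableT)).
  exact: (measurable_fubini_F ik).
apply: ae_eq_integral => //.
- apply/measurable_EFinP; apply: measurable_funB; apply: measurable_funM => //; exact: mF.
- by apply/measurable_EFinP; exact: (mF _ i12).
have h1 := ae_integrable1 ik1; have h2 := ae_integrable1 ik2.
apply: filterS2 h1 h2 => t h1 h2 _; congr EFin.
rewrite -[LHS]/(e1 t * (\int[mu]_r k1 (t, r)) - e2 t * (\int[mu]_r k2 (t, r))).
rewrite -[RHS]/(\int[mu]_r (e1 t * k1 (t, r) - e2 t * k2 (t, r))).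
rewrite -!RintegralZl// -RintegralB//.
  by have := integrableZl measurableT (e1 t) h1; apply: eq_integrable => // r _; rewrite EFinM.
by have := integrableZl measurableT (e2 t) h2; apply: eq_integrable => // r _; rewrite EFinM.
Qed.

(** By Tonelli's theorem the integral of the modulus is computed by integrating
    first in z.1, where translation invariance makes the integral of
    |a (z.1 + z.2)| independent of z.2. *)
Lemma integrable_shear (a b : mT -> R) : mu.-integrable setT (EFin \o a) ->
  mu.-integrable setT (EFin \o b) -> int2 (fun z => a (z.1 + z.2) * b z.2).
Proof.
move=> ia ib.
have ma : measurable_fun setT a by apply/measurable_EFinP; exact: measurable_int ia.
have mb : measurable_fun setT b by apply/measurable_EFinP; exact: measurable_int ib.
have madd : measurable_fun setT (fun z : mT * mT => (z.1 + z.2 : mT)).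
  by apply: measurable_funD.
apply/(integrable21ltyP mu mu).
  apply/measurable_EFinP; apply: measurable_funM; exact: measurableT_comp.
under eq_integral => r _.
  under eq_integral do rewrite /= normrM EFinM muleC.
  rewrite ge0_integralZl//; last first.
    apply/measurable_EFinP; apply: measurableT_comp => //.
    exact: (measurableT_comp ma (measurable_shift_by r)).
  rewrite (@ge0_integral_shift _ r (fun t => `|a t|%:E))//; last first.
    by apply/measurable_EFinP; exact: measurableT_comp.
  over.
have /integrableP[_ fa] := ia; have /integrableP[_ fb] := ib.
rewrite /=.
have fina : (\int[mu]_t `|a t|%:E)%E \is a fin_num.
  by rewrite ge0_fin_numE//; exact: integral_ge0.
rewrite -(fineK fina); under eq_integral do rewrite muleC.
rewrite ge0_integralZl//.
- by rewrite lte_mul_pinfty// lee_fin fine_ge0// integral_ge0.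
- by apply/measurable_EFinP; exact: measurableT_comp.
- by rewrite lee_fin fine_ge0// integral_ge0.
Qed.

End weighted_fubini.

(** * The iterated integral over a triangle *)

Section triangle.
Context {R : realType}.
Notation mu := (@lebesgue_measure R).
Local Notation mT := (measurableTypeR R).
Implicit Types (f g : R -> R[i]) (z w : R[i]) (x t r : R).
Notation rint h := (mu.-integrable setT (EFin \o h)).

Definition cintegrable_on (D : set mT) f :=
  mu.-integrable D (EFin \o (fun t => complex.Re (f t))) /\
  mu.-integrable D (EFin \o (fun t => complex.Im (f t))).

Lemma eq_cintegral (u v : R) f g : (forall t, u <= t <= v -> f t = g t) ->
  cintegral u v f = cintegral u v g.
Proof.
by move=> fg; congr (_ +i* _); apply: eq_Rintegral => t;
  rewrite inE/= in_itv/= => /fg ->.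
Qed.

Lemma cintegralMl (u v : R) z f : cintegrable_on `[u, v]%classic f ->
  cintegral u v (fun t => z * f t) = z * cintegral u v f.
Proof.
move=> [i1 i2]; have mI : measurable (`[u, v]%classic : set mT) by exact: measurable_itv.
have iZ k (h : R -> R) : mu.-integrable `[u, v] (EFin \o h) ->
    mu.-integrable `[u, v] (EFin \o (fun t => k * h t)).
  move=> ih; have := integrableZl mI k ih.
  by apply: eq_integrable => // t _; rewrite EFinM.
apply: complex_eq; rewrite ?ReM ?ImM /cintegral/= -!RintegralZl//.
  rewrite -RintegralB//; [|exact: iZ..].
  by apply: eq_Rintegral => t _; rewrite ReM.
rewrite -RintegralD//; [|exact: iZ..].
by apply: eq_Rintegral => t _; rewrite ImM.
Qed.

Lemma cintegrable_onZ (D : set mT) z f : measurable D -> cintegrable_on D f ->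
  cintegrable_on D (fun t => z * f t).
Proof.
move=> mD [i1 i2]; split.
  have := integrableB mD (integrableZl mD (complex.Re z) i1) (integrableZl mD (complex.Im z) i2).
  by apply: eq_integrable => // t _; rewrite /= ReM EFinB !EFinM.
have := integrableD mD (integrableZl mD (complex.Re z) i2) (integrableZl mD (complex.Im z) i1).
by apply: eq_integrable => // t _; rewrite /= ImM EFinD !EFinM.
Qed.

Lemma cintegralB (u v : R) f g : cintegrable_on `[u, v]%classic f ->
  cintegrable_on `[u, v]%classic g ->
  cintegral u v (fun t => f t - g t) = cintegral u v f - cintegral u v g.
Proof.
move=> [i1 i2] [j1 j2]; have mI : measurable (`[u, v]%classic : set mT) by exact: measurable_itv.
apply: complex_eq; rewrite ?ReD ?ReN ?ImD ?ImN /cintegral/= -RintegralB//.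
  by apply: eq_Rintegral => t _; rewrite ReD ReN.
by apply: eq_Rintegral => t _; rewrite ImD ImN.
Qed.

Lemma cintegrable_itv f (u v : R) : cintegrable f -> cintegrable_on `[u, v]%classic f.
Proof. by move=> [? ?]; split; exact: rint_itv. Qed.

Definition cut x f t : R[i] := if 0 <= t <= x then f t else 0.

Lemma cutE x f t : 0 <= t <= x -> cut x f t = f t.
Proof. by rewrite /cut => ->. Qed.

Lemma Re_cut x f : (fun t => complex.Re (cut x f t)) = (fun t => complex.Re (f t)) \_ `[0, x].
Proof.
apply/funext => t; rewrite patchE /cut; case: ifP => h; first by rewrite mem_set//= in_itv.
by rewrite memNset//= in_itv/= h.
Qed.

Lemma Im_cut x f : (fun t => complex.Im (cut x f t)) = (fun t => complex.Im (f t)) \_ `[0, x].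
Proof.
apply/funext => t; rewrite patchE /cut; case: ifP => h; first by rewrite mem_set//= in_itv.
by rewrite memNset//= in_itv/= h.
Qed.

Lemma cintegrable_cut x f : cintegrable_on `[0, x]%classic f -> cintegrable (cut x f).
Proof.
have mI : measurable (`[0%R, x]%classic : set mT) by exact: measurable_itv.
move=> [i1 i2]; rewrite /cintegrable Re_cut Im_cut -!restrict_EFin; split.
  exact: ((@integrable_mkcond _ mT R mu _ (EFin \o _) mI).1 i1).
exact: ((@integrable_mkcond _ mT R mu _ (EFin \o _) mI).1 i2).
Qed.

(** Cutting e, al and be off outside [0, x] makes their product vanish outside
    the triangle 0 <= t, 0 <= r, t + r <= x, so that Fubini's theorem on the
    whole plane exchanges the two integrals over the triangle. *)
Lemma triangle_swap x (al be a b e : R -> R[i]) (M : R) :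
  cintegrable al -> cintegrable be ->
  measurable_fun setT (fun t : mT => complex.Re (cut x e t)) ->
  measurable_fun setT (fun t : mT => complex.Im (cut x e t)) ->
  (forall t, normc (cut x e t) <= M) ->
  (forall t r, 0 <= t -> 0 <= r -> t + r <= x ->
     e t * (al (t + r) * be r) = a (t + r) * b r) ->
  cintegral 0 x (fun t => e t * cintegral 0 (x - t) (fun r => al (t + r) * be r)) =
  cintegral 0 x (fun r => cintegral 0 (x - r) (fun t => a (t + r) * b r)).
Proof.
move=> ial ibe mr mi eM hab.
have [ir ii] := cintegrable_cut (cintegrable_itv 0 x ial).
have [jr ji] := cintegrable_cut (cintegrable_itv 0 x ibe).
pose K t r := cut x al (t + r) * cut x be r.
have K0 t r : 0 <= t <= x -> ~~ (0 <= r <= x - t) -> K t r = 0.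
  move=> /andP[t0 tx] h; rewrite /K /cut; case: ifP => /=; last by rewrite mul0r.
  move=> /andP[tr0 trx]; case: ifP => [/andP[r0 rx]|]; last by rewrite mulr0.
  by move: h; rewrite r0/= lerBrDl trx.
have KE t r : 0 <= t <= x -> 0 <= r <= x - t -> K t r = al (t + r) * be r.
  move=> /andP[t0 tx] /andP[r0 rxt]; rewrite /K !cutE//; first by rewrite r0/=; lra.
  by rewrite addr_ge0//=; lra.
pose k1 (z : mT * mT) := complex.Re (K z.1 z.2).
pose k2 (z : mT * mT) := complex.Im (K z.1 z.2).
have ik1 : (mu \x mu)%E.-integrable setT (EFin \o k1).
  have := integrableB measurableT (integrable_shear ir jr) (integrable_shear ii ji).
  by apply: eq_integrable => // z _; rewrite /k1 /K /= ReM EFinB.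
have ik2 : (mu \x mu)%E.-integrable setT (EFin \o k2).
  have := integrableD measurableT (integrable_shear ir ji) (integrable_shear ii jr).
  by apply: eq_integrable => // z _; rewrite /k2 /K /= ImM EFinD.
have inner (p : R[i] -> R) t : p 0 = 0 -> 0 <= t <= x ->
    \int[mu]_r p (K t r) = \int[mu]_(r in `[0, x - t]) p (al (t + r) * be r).
  move=> p0 t01; rewrite [RHS]Rintegral_mkcond; apply: eq_Rintegral => r _.
  rewrite patchE; case: ifPn => h; first by rewrite KE//; move: h; rewrite inE/= in_itv.
  by rewrite K0//; move: h; rewrite notin_setE/= in_itv/= => /negP.
have outer (p : R[i] -> R) r : p 0 = 0 -> 0 <= r <= x ->
    \int[mu]_t p (cut x e t * K t r) =
    \int[mu]_(t in `[0, x - r]) p (a (t + r) * b r).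
  move=> p0 /andP[r0 rx]; rewrite [RHS]Rintegral_mkcond; apply: eq_Rintegral => t _.
  rewrite patchE; case: ifPn => h.
    move: h; rewrite inE/= in_itv/= => /andP[t0 txr].
    have t0x : 0 <= t <= x by rewrite t0/=; lra.
    by rewrite cutE// KE ?hab//; [lra|rewrite r0/=; lra].
  move: h; rewrite notin_setE/= in_itv/= => h.
  rewrite /cut; case: ifP => [/andP[t0 tx]|_]; last by rewrite mul0r.
  rewrite /K /cut; case: ifP => /= [/andP[_ trx]|]; last by rewrite mul0r mulr0.
  by exfalso; apply: h; rewrite t0/=; lra.
have outer0 (p : R[i] -> R) r : p 0 = 0 -> ~~ (0 <= r <= x) ->
    \int[mu]_t p (cut x e t * K t r) = 0.
  move=> p0 r01; rewrite (_ : \int[mu]_t _ = \int[mu]_t (0 : R)).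
    by rewrite Rintegral_cst// mul0r.
  by apply: eq_Rintegral => t _; rewrite /K [cut x be r]/cut (negbTE r01) !mulr0.
have eRe t : `|complex.Re (cut x e t)| <= M := le_trans (normc_Re _) (eM t).
have eIm t : `|complex.Im (cut x e t)| <= M := le_trans (normc_Im _) (eM t).
have eNRe t : `|- complex.Re (cut x e t)| <= M by rewrite normrN; exact: eRe.
have mNr : measurable_fun setT (fun t : mT => - complex.Re (cut x e t)).
  exact: measurableT_comp.
rewrite /cintegral/=; congr (_ +i* _).
- transitivity (\int[mu]_t (complex.Re (cut x e t) * (\int[mu]_r k1 (t, r)) -
                           complex.Im (cut x e t) * (\int[mu]_r k2 (t, r)))).
    rewrite [LHS]Rintegral_mkcond; apply: eq_Rintegral => t _.
    rewrite patchE /cut; case: ifPn => h.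
      move: h; rewrite inE/= in_itv/= => h; rewrite h ReM /cintegral/=.
      by rewrite (inner (@complex.Re R))// (inner (@complex.Im R)).
    by move: h; rewrite notin_setE/= in_itv/= => /negP/negbTE ->; rewrite !mul0r subrr.
  rewrite (@Rfubini_weighted R k1 k2 _ _ M ik1 ik2 mr mi eRe eIm).
  rewrite [RHS]Rintegral_mkcond; apply: eq_Rintegral => r _.
  rewrite (_ : \int[mu]_t _ = \int[mu]_t complex.Re (cut x e t * K t r)); last first.
    by apply: eq_Rintegral => t _; rewrite ReM.
  rewrite patchE; case: ifPn => h.
    by rewrite (outer (@complex.Re R))//; move: h; rewrite inE/= in_itv.
  by rewrite (outer0 (@complex.Re R))//; move: h; rewrite notin_setE/= in_itv/= => /negP.
- transitivity (\int[mu]_t (complex.Im (cut x e t) * (\int[mu]_r k1 (t, r)) -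
                           - complex.Re (cut x e t) * (\int[mu]_r k2 (t, r)))).
    rewrite [LHS]Rintegral_mkcond; apply: eq_Rintegral => t _.
    rewrite patchE /cut; case: ifPn => h.
      move: h; rewrite inE/= in_itv/= => h; rewrite h ImM /cintegral/=.
      by rewrite (inner (@complex.Re R))// (inner (@complex.Im R))// mulNr opprK addrC.
    by move: h; rewrite notin_setE/= in_itv/= => /negP/negbTE ->; rewrite oppr0 !mul0r subrr.
  rewrite (@Rfubini_weighted R k1 k2 _ _ M ik1 ik2 mi mNr eIm eNRe).
  rewrite [RHS]Rintegral_mkcond; apply: eq_Rintegral => r _.
  rewrite (_ : \int[mu]_t _ = \int[mu]_t complex.Im (cut x e t * K t r)); last first.
    by apply: eq_Rintegral => t _; rewrite ImM mulNr opprK addrC.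
  rewrite patchE; case: ifPn => h.
    by rewrite (outer (@complex.Im R))//; move: h; rewrite inE/= in_itv.
  by rewrite (outer0 (@complex.Im R))//; move: h; rewrite notin_setE/= in_itv/= => /negP.
Qed.

(** The substitution s = t + r turns the left-hand side into the integral of
    a s * z over [r, x]. *)
Lemma cintegral_shift_tail (a : R -> R[i]) z x r : cintegrable a -> 0 <= r <= x ->
  cintegral 0 (x - r) (fun t => a (t + r) * z) =
  (cintegral 0 x a - cintegral 0 r a) * z.
Proof.
move=> [i1 i2] /andP[r0 rx].
have shift (h : R -> R) : rint h ->
    \int[mu]_(t in `[0, x - r]) h (t + r) =
    \int[mu]_(t in `[0, x]) h t - \int[mu]_(t in `[0, r]) h t.
  move=> ih; rewrite Rintegral_itvB ?bnd_simp//; last exact: rint_itv.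
  rewrite Rintegral_itv_obnd_cbnd; last exact: rint_itv.
  by rewrite -(Rintegral_shift r)// subrr.
have ishift (h : R -> R) : rint h ->
    mu.-integrable `[0, x - r] (EFin \o (fun t => h (t + r))).
  move=> ih; apply: (integrableS measurableT) => //.
  have mS := measurable_shift_by r.
  have mh : measurable_fun setT (EFin \o h) := measurable_int mu ih.
  apply/integrableP; split; first exact: (measurableT_comp mh mS).
  have /integrableP[_] := ih.
  by rewrite -(@ge0_integral_shift _ r)//; exact: measurableT_comp.
rewrite (@eq_cintegral _ _ _ (fun t => z * a (t + r))) => [|t _]; last by rewrite mulrC.
rewrite cintegralMl; last by split; [exact: (ishift _ i1)|exact: (ishift _ i2)].
rewrite mulrC; congr (_ * _); apply: complex_eq; rewrite ?ReD ?ReN ?ImD ?ImN /=.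
  exact: (shift _ i1).
exact: (shift _ i2).
Qed.

Lemma int01_bounded_mul (f h : R -> R) (M : R) :
  mu.-integrable `[0, 1]%classic (EFin \o f) ->
  {within `[0, 1], continuous h} -> (forall t, 0 <= t <= 1 -> `|h t| <= M) ->
  mu.-integrable `[0, 1]%classic (EFin \o (fun t => f t * h t)).
Proof.
move=> intf ch hM.
have mh : measurable_fun (`[0%R : R, 1%R]%classic : set mT) h.
  exact: subspace_continuous_measurable_fun.
have mf : measurable_fun (`[0%R : R, 1%R]%classic : set mT) f.
  by apply/measurable_EFinP; exact: measurable_int intf.
have := int01Z M intf; apply: le_integrable => //.
  by apply/measurable_EFinP; exact: measurable_funM.
move=> t; rewrite /= in_itv/= => t01; rewrite lee_fin !normrM mulrC ler_wpM2r//.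
by rewrite (le_trans (hM t t01))// ler_norm.
Qed.

Lemma cintegrable01M f g : cintegrable_on `[0, 1]%classic f -> abs_continuous01 g ->
  cintegrable_on `[0, 1]%classic (fun t => f t * g t).
Proof.
move=> [i1 i2] acg; have [M M0 gM] := ac_bounded acg.
have [cr ci] := ac_continuous01 acg.
have gr t : 0 <= t <= 1 -> `|complex.Re (g t)| <= M by move=> /gM; exact: le_trans (normc_Re _).
have gi t : 0 <= t <= 1 -> `|complex.Im (g t)| <= M by move=> /gM; exact: le_trans (normc_Im _).
split.
  have := integrableB measurable01 (int01_bounded_mul i1 cr gr) (int01_bounded_mul i2 ci gi).
  by apply: eq_integrable => [|t _]; [exact: measurable01|rewrite /= ReM EFinB].
have := integrableD measurable01 (int01_bounded_mul i1 ci gi) (int01_bounded_mul i2 cr gr).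
by apply: eq_integrable => [|t _]; [exact: measurable01|rewrite /= ImM EFinD].
Qed.

Lemma cintegrable_onS (D E : set mT) f : measurable D -> measurable E -> E `<=` D ->
  cintegrable_on D f -> cintegrable_on E f.
Proof. by move=> mD mE ED [? ?]; split; exact: (integrableS mD mE ED). Qed.

(** The right-hand side is the integral over 0 <= r <= s <= x of a s * b r,
    written without double integral so that its derivative in x is visible. *)
Lemma triangle_integral x (al be a b e : R -> R[i]) :
  0 <= x <= 1 -> cintegrable al -> cintegrable be -> cintegrable a -> cintegrable b ->
  abs_continuous01 e ->
  (forall t r, 0 <= t -> 0 <= r -> t + r <= x ->
     e t * (al (t + r) * be r) = a (t + r) * b r) ->
  cintegral 0 x (fun t => e t * cintegral 0 (x - t) (fun r => al (t + r) * be r)) =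
  cintegral 0 x a * cintegral 0 x b -
  cintegral 0 x (fun r => b r * cintegral 0 r a).
Proof.
move=> x01 ial ibe ia ib ace hab; have /andP[x0 x1] := x01.
have mI : measurable (`[0%R, x]%classic : set mT) by exact: measurable_itv.
have sI : `[0%R, x]%classic `<=` `[0%R, 1%R].
  by move=> t /=; rewrite !in_itv/= => /andP[-> /le_trans]; exact.
have [M M0 eM] := ac_bounded ace; have [cr ci] := ac_continuous01 ace.
have mcut (h : R -> R) : {within `[0, 1], continuous h} ->
    measurable_fun setT ((h \_ `[0, x]) : mT -> R).
  move=> ch; apply/(measurable_restrictT _ mI).
  apply: (measurable_funS measurable01 sI).
  exact: subspace_continuous_measurable_fun.
rewrite (@triangle_swap x al be a b e M)//; last 3 first.
- by rewrite Re_cut; exact: mcut.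
- by rewrite Im_cut; exact: mcut.
- move=> t; rewrite /cut; case: ifP => [/andP[t0 tx]|_]; last by rewrite normc0.
  by apply: eM; rewrite t0 (le_trans tx).
rewrite (@eq_cintegral _ _ _ (fun r => cintegral 0 x a * b r - b r * cintegral 0 r a)); last first.
  by move=> r r0x; rewrite cintegral_shift_tail// mulrBl [_ * b r in X in _ - X]mulrC.
have ibx := cintegrable_itv 0 x ib.
rewrite cintegralB; first by rewrite cintegralMl.
  exact: cintegrable_onZ.
apply: (cintegrable_onS measurable01 mI sI).
apply: cintegrable01M; [exact: cintegrable_itv|exact: ac_cprim].
Qed.

End triangle.

(** * The columns of the solution *)

Section oscillation.
Context {R : realType}.
Notation mu := (@lebesgue_measure R).
Local Notation mT := (measurableTypeR R).
Implicit Types (f g al be : R -> R[i]) (z w : R[i]) (x t r : R).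
Notation int01 h := (mu.-integrable `[0, 1]%classic (EFin \o h)).
Notation I01 h := (\int[mu]_(t in `[0, 1]) h t).
Local Notation D01 := (`[0%R : R, 1%R]%classic : set mT).

Lemma eq_ac01 f g : (forall t, 0 <= t <= 1 -> f t = g t) ->
  abs_continuous01 f -> abs_continuous01 g.
Proof.
move=> fg acf.
apply: (@ac_incr_dom R 1 0 (fun a b => normc (g b - g a)) _ _ ler01 (lexx 0) acf (@ac_incr_length R)).
move=> a b a0 ab b1; rewrite mul1r mul0r addr0.
have b01 : 0 <= b <= 1 by rewrite (le_trans a0).
have a01 : 0 <= a <= 1 by rewrite a0 (le_trans ab).
by rewrite -(fg b b01) -(fg a a01); exact: lexx.
Qed.

Lemma ac_real_normc f : abs_continuous01 f -> ac_real (fun t => normc (f t)).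
Proof.
move=> acf.
apply: (@ac_incr_dom R 1 0 _ _ _ ler01 (lexx 0) acf (@ac_incr_length R)).
move=> a b a0 ab b1; rewrite mul1r mul0r addr0.
have h1 := normc_add (f b - f a) (f a); rewrite subrK in h1.
have h2 := normc_add (f a - f b) (f b).
rewrite subrK -[normc (f a - f b)]normc_opp opprB in h2.
rewrite ler_norml; apply/andP; split; [rewrite lerNl opprB|]; rewrite lerBlDr.
  exact: h2.
exact: h1.
Qed.

Lemma int01_ac_mul (f h : R -> R) : int01 f -> ac_real h ->
  int01 (fun t => f t * h t).
Proof.
move=> intf ach; have [M M0 hM] := ac_real_bounded ach.
exact: int01_bounded_mul intf (ac_real_continuous ach) hM.
Qed.

Lemma cintegrable_normc f : cmeasurable01 f -> int01 (fun t => normc (f t)) ->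
  cintegrable_on D01 f.
Proof.
move=> [mr mi] intn; split.
  apply: (le_integrable measurable01 _ _ intn); first exact/measurable_EFinP.
  by move=> t _; rewrite lee_fin (le_trans (normc_Re _))// ler_norm.
apply: (le_integrable measurable01 _ _ intn); first exact/measurable_EFinP.
by move=> t _; rewrite lee_fin (le_trans (normc_Im _))// ler_norm.
Qed.

(** The cut-off makes the modulated function integrable on the whole line, as
    [ae_cprim] requires. *)
Definition modulated w f : R -> R[i] := cut 1 (fun t => cexp (w * t%:C) * f t).

Lemma cintegrable_modulated w f : cintegrable_on D01 f -> cintegrable (modulated w f).
Proof.
move=> intf; apply: cintegrable_cut.
have [h1 h2] := cintegrable01M intf (ac_cexp w); split.
  by move: h1; apply: eq_integrable => [|t _]; [exact: measurable01|rewrite /= mulrC].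
by move: h2; apply: eq_integrable => [|t _]; [exact: measurable01|rewrite /= mulrC].
Qed.

Lemma normc_modulated w f t : 0 <= t <= 1 ->
  normc (modulated w f t) <= expR `|complex.Re w| * normc (f t).
Proof.
move=> t01; rewrite /modulated cutE// normcM.
by apply: ler_wpM2r; [exact: normc_nneg|exact: normc_cexp_le].
Qed.

Definition modprim w f x := cintegral 0 x (modulated w f).

(** Its derivative is modulated w f * modprim w' g almost everywhere, by the
    product rule; the form is the one that [triangle_integral] produces. *)
Definition second_term w f w' g x :=
  modprim w f x * modprim w' g x -
  cintegral 0 x (fun r => modulated w' g r * modprim w f r).

Lemma oscE f s m x : x <= 1 -> osc f s m x = modprim (s%:C * 'i%C * m) f x.
Proof.
move=> x1; apply: eq_cintegral => t /andP[t0 tx].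
by rewrite /modulated cutE// t0 (le_trans tx).
Qed.

Lemma ac_osc f s m : cintegrable_on D01 f -> abs_continuous01 (osc f s m).
Proof.
move=> intf; apply: (eq_ac01 _ (ac_cprim (cintegrable_modulated (s%:C * 'i%C * m) intf))).
by move=> t /andP[_ t1]; rewrite oscE.
Qed.

Lemma cintegrable_modM w f w' g : cintegrable_on D01 f -> cintegrable_on D01 g ->
  cintegrable (cut 1 (fun r => modulated w' g r * modprim w f r)).
Proof.
move=> intf intg; apply: cintegrable_cut; apply: cintegrable01M.
  exact: cintegrable_itv (cintegrable_modulated _ _).
exact/ac_cprim/cintegrable_modulated.
Qed.

Lemma cut_modM w f w' g : cut 1 (fun r => modulated w' g r * modprim w f r) =
  (fun r => modulated w' g r * modprim w f r).
Proof.
apply/funext => r; rewrite {1}/cut; case: ifP => // h.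
by rewrite [modulated w' g r]/modulated /cut h mul0r.
Qed.

(** The exponentials e^{-wx} X and e^{wx} Y solve the off-diagonal system, and
    multiplying the estimates of [column_bounds] by e^{wx} or e^{-wx} costs at
    most the factor e^d. *)
Lemma dirac_column (d : R) w al be (X Y : R -> R[i]) (sg G : R -> R) :
  `|complex.Re w| <= d -> cintegrable_on D01 al -> cintegrable_on D01 be ->
  int01 sg -> (forall t, 0 <= sg t) -> (forall t, 0 <= G t) -> ac_real G ->
  (forall t, normc (al t) <= sg t) -> (forall t, normc (be t) <= sg t) ->
  (forall t, 0 <= t <= 1 -> normc (modprim (w + w) be t) <= G t) ->
  abs_continuous01 X -> abs_continuous01 Y -> X 0 = 1 -> Y 0 = 0 ->
  {ae mu, forall t : R, 0 <= t <= 1 ->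
     cderive_at X t (w * X t - al t * Y t) /\
     cderive_at Y t (- (w * Y t) - be t * X t)} ->
  let C := expR d * column_cst (expR (2 * d)) (I01 sg) in
  let B := I01 (fun t => sg t * G t) in
  let B2 := I01 (fun t => sg t * G t ^+ 2) in
  forall x, 0 <= x <= 1 ->
  [/\ normc (X x) <= C, normc (Y x) <= C,
      normc (X x - cexp (w * x%:C)) <= C * B /\ normc (Y x) <= C * (B + G x),
      normc (Y x + cexp (- w * x%:C) * modprim (w + w) be x) <=
        C * (G x * B + (B ^+ 2 + B2)) &
      normc (X x - cexp (w * x%:C) -
             cexp (w * x%:C) * second_term (- (w + w)) al (w + w) be x) <=
        C * (B ^+ 2 + B2)].
Proof.
move=> wd ial ibe isg sg0 G0 acG alsg besg SG acX acY X0 Y0 dXY C B B2 x x01.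
pose u t := cexp (- w * t%:C) * X t; pose v t := cexp (w * t%:C) * Y t.
pose s1 := modulated (- (w + w)) al; pose s2 := modulated (w + w) be.
pose S := modprim (w + w) be; pose T := second_term (- (w + w)) al (w + w) be.
have is1 : cintegrable s1 by exact: cintegrable_modulated.
have is2 : cintegrable s2 by exact: cintegrable_modulated.
have isT := cintegrable_modM (- (w + w)) (w + w) ial ibe.
rewrite cut_modM in isT.
have ww : `|complex.Re (w + w)| <= 2 * d.
  by rewrite ReD (le_trans (ler_normD _ _))// mulr_natl mulr2n lerD.
have K0 : 0 <= expR (2 * d) by exact: expR_ge0.
have hs1 t : 0 <= t <= 1 -> normc (s1 t) <= expR (2 * d) * sg t.
  move=> t01; rewrite (le_trans (normc_modulated _ _ t01))//.
  by apply: ler_pM; rewrite ?expR_ge0 ?normc_nneg// ler_expR ReN normrN.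
have hs2 t : 0 <= t <= 1 -> normc (s2 t) <= expR (2 * d) * sg t.
  move=> t01; rewrite (le_trans (normc_modulated _ _ t01))//.
  by apply: ler_pM; rewrite ?expR_ge0 ?normc_nneg// ler_expR.
have acu : abs_continuous01 u by apply: acM => //; exact: ac_cexp.
have acv : abs_continuous01 v by apply: acM => //; exact: ac_cexp.
have eM t : cexp (- w * t%:C) * cexp (w * t%:C) = 1 by rewrite mulNr cexpNM.
have duv : {ae mu, forall t : R, 0 <= t <= 1 ->
     cderive_at u t (- (s1 t * v t)) /\ cderive_at v t (- (s2 t * u t))}.
  apply: filterS dXY => t dXY t01; have [dX dY] := dXY t01.
  have e2 : cexp (w * t%:C) * cexp (w * t%:C) = cexp ((w + w) * t%:C).
    by rewrite mulrDl cexpD.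
  have e3 : cexp (- w * t%:C) * cexp (- w * t%:C) = cexp (- (w + w) * t%:C).
    by rewrite opprD mulrDl cexpD.
  split.
    have := cderiveM (cderive_cexp (- w) t) dX.
    rewrite (_ : _ * X t + _ = - (s1 t * v t))// /s1 /v /modulated cutE// -e3.
    have := eM t; move: (cexp (- w * t%:C)) (cexp (w * t%:C)) => E E' EE.
    transitivity (- (E * al t * Y t)); first by ring.
    by rewrite (_ : E * E * al t * (E' * Y t) = E * (E * E') * al t * Y t); [rewrite EE mulr1|ring].
  have := cderiveM (cderive_cexp w t) dY.
  rewrite (_ : _ * Y t + _ = - (s2 t * u t))// /s2 /u /modulated cutE// -e2.
  have := eM t; move: (cexp (- w * t%:C)) (cexp (w * t%:C)) => E E' EE.
  transitivity (- (E' * be t * X t)); first by ring.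
  by rewrite (_ : E' * E' * be t * (E * X t) = E' * (E * E') * be t * X t); [rewrite EE mulr1|ring].
have u0 : u 0 = 1 by rewrite /u mulr0 cexp0 X0 mulr1.
have v0 : v 0 = 0 by rewrite /v Y0 mulr0.
have acS : abs_continuous01 S by exact: ac_cprim.
have S0 : S 0 = 0 by exact: cprim0.
have dS : {ae mu, forall t : R, 0 <= t <= 1 -> cderive_at S t (s2 t)}.
  by have := ae_cprim is2; apply: filterS => t h /andP[t0 _]; exact: h.
have acT : abs_continuous01 T.
  apply: acD; last by apply: acN; exact: ac_cprim.
  by apply: acM; exact: ac_cprim.
have T0 : T 0 = 0 by rewrite /T /second_term /modprim !cprim0 mul0r subr0.
have dT : {ae mu, forall t : R, 0 <= t <= 1 -> cderive_at T t (s1 t * S t)}.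
  have h1 := ae_cprim is1; have hT := ae_cprim isT.
  apply: filterS3 h1 dS hT => t h1 dS hT t01; have t0 := (andP t01).1.
  have := cderiveD (cderiveM (h1 t0) (dS t01)) (cderiveN (hT t0)).
  rewrite (_ : _ + _ - _ = s1 t * S t)//.
  by rewrite -/s1 -/s2 /modprim -/s1 -/s2; ring.
have isG : int01 (fun t => sg t * G t) by exact: int01_ac_mul.
have isG2 : int01 (fun t => sg t * G t ^+ 2).
  by apply: (int01_ac_mul isg); under eq_fun do rewrite expr2; exact: ac_realM.
have := column_bounds K0 isg sg0 G0 isG isG2 hs1 hs2 acu acv duv u0 v0 acS S0 dS SG acT T0 dT x01.
rewrite -/B -/B2; set C' := column_cst _ _ => -[ub vb [ub1 vb1] wb zb].
have CE : C = expR d * C' by [].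
have e1 : normc (cexp (w * x%:C)) <= expR d.
  by rewrite (le_trans (normc_cexp_le _ x01))// ler_expR.
have e2 : normc (cexp (- w * x%:C)) <= expR d.
  by rewrite (le_trans (normc_cexp_le _ x01))// ler_expR ReN normrN.
have scale1 z y : normc z <= y -> normc (cexp (w * x%:C) * z) <= expR d * y.
  by move=> zy; rewrite normcM; apply: ler_pM; rewrite ?normc_nneg.
have scale2 z y : normc z <= y -> normc (cexp (- w * x%:C) * z) <= expR d * y.
  by move=> zy; rewrite normcM; apply: ler_pM; rewrite ?normc_nneg.
have XE : X x = cexp (w * x%:C) * u x.
  by rewrite /u mulrA [cexp _ * cexp _]mulrC eM mul1r.
have YE : Y x = cexp (- w * x%:C) * v x by rewrite /v mulrA eM mul1r.
rewrite CE -!mulrA; split.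
- by rewrite XE; exact: scale1.
- by rewrite YE; exact: scale2.
- split; last by rewrite YE; exact: scale2.
  by rewrite XE -[X in _ - X]mulr1 -mulrBr; exact: scale1.
- by rewrite YE -mulrDr; exact: scale2.
- by rewrite XE -[X in _ * u x - X]mulr1 -mulrBr -mulrBr; exact: scale1.
Qed.

(** Since x - 2 t = x - 2 (t + r) + 2 r, the exponential in front of the inner
    integral splits into e^{wx} and the modulations of al at t + r and of be
    at r. *)
Lemma diagonal_second_term w al be x :
  cintegrable_on D01 al -> cintegrable_on D01 be -> 0 <= x <= 1 ->
  cintegral 0 x (fun t => cexp (w * (x - 2 * t)%:C) *
    cintegral 0 (x - t) (fun r => al (t + r) * be r)) =
  cexp (w * x%:C) * second_term (- (w + w)) al (w + w) be x.
Proof.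
move=> ial ibe x01; have /andP[x0 x1] := x01.
have mI : measurable (`[0%R, x]%classic : set mT) by exact: measurable_itv.
set z := cexp (w * x%:C).
have eE t : cexp (w * (x - 2 * t)%:C) = z * cexp (- (w + w) * t%:C).
  rewrite -cexpD; congr cexp; rewrite rmorphB rmorphM/= rmorph_nat; ring.
pose a t := z * modulated (- (w + w)) al t.
pose b := modulated (w + w) be.
have is1 := cintegrable_modulated (- (w + w)) ial.
have is2 := cintegrable_modulated (w + w) ibe.
have ia : cintegrable a by apply: cintegrable_onZ.
rewrite (@eq_cintegral _ _ _ _ (fun t => (z * cexp (- (w + w) * t%:C)) *
    cintegral 0 (x - t) (fun r => cut 1 al (t + r) * cut 1 be r))); last first.
  move=> t /andP[t0 tx]; rewrite eE; congr (_ * _).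
  apply: eq_cintegral => r /andP[r0 rx]; rewrite !cutE//; first by rewrite r0/=; lra.
  by rewrite addr_ge0//=; lra.
rewrite (@triangle_integral _ x (cut 1 al) (cut 1 be) a b)//.
- have aE r : r <= 1 -> cintegral 0 r a = z * modprim (- (w + w)) al r.
    by move=> r1; rewrite cintegralMl//; exact: cintegrable_itv.
  rewrite aE// /second_term mulrBr mulrA; congr (_ - _).
  rewrite -cintegralMl; last first.
    by rewrite -cut_modM; exact: cintegrable_itv (cintegrable_modM _ _ _ _).
  apply: eq_cintegral => r /andP[r0 rx]; rewrite aE ?(le_trans rx)//.
  by rewrite /b; ring.
- exact: cintegrable_cut.
- exact: cintegrable_cut.
- by apply: acM; [exact: ac_cst|exact: ac_cexp].
- move=> t r t0 r0 tr; rewrite /a /b /modulated !cutE; [|lra..].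
  have -> : cexp (- (w + w) * t%:C) = cexp (- (w + w) * (t + r)%:C) * cexp ((w + w) * r%:C).
    by rewrite -cexpD; congr cexp; rewrite rmorphD/=; ring.
  by ring.
Qed.

End oscillation.

(** * The quantities gamma *)

Section gamma_bounds.
Context {R : realType}.
Notation mu := (@lebesgue_measure R).
Notation int01 h := (mu.-integrable `[0, 1]%classic (EFin \o h)).
Notation I01 h := (\int[mu]_(t in `[0, 1]) h t).
Local Notation D01 := (`[0%R : R, 1%R]%classic : set (measurableTypeR R)).
Variables (p : R) (sigma1 sigma2 : R -> R[i]) (m : R[i]).
Hypotheses (p1 : 1 <= p) (h1 : in_Lp p%:E sigma1) (h2 : in_Lp p%:E sigma2).

Lemma Lp_cintegrable f : in_Lp p%:E f -> cintegrable_on D01 f.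
Proof. by move=> hf; apply: cintegrable_normc; [case: hf|exact: Lp_int01 hf]. Qed.

Lemma osc_cmeasurable f s : in_Lp p%:E f -> cmeasurable01 (osc f s m).
Proof.
move=> hf; have [cr ci] := ac_continuous01 (ac_osc s m (Lp_cintegrable hf)).
by split; exact: subspace_continuous_measurable_fun.
Qed.

Lemma int01_sigma0 : int01 (sigma0 sigma1 sigma2).
Proof. by apply: int01D; [exact: Lp_int01 h1|exact: Lp_int01 h2]. Qed.

Lemma sigma0_ge0 t : 0 <= sigma0 sigma1 sigma2 t.
Proof. by rewrite addr_ge0 ?normc_nneg. Qed.

Lemma a1E : a1 sigma1 sigma2 = I01 (sigma0 sigma1 sigma2).
Proof. by rewrite /a1 !Lpnorm1E -I01D//; [exact: Lp_int01 h1|exact: Lp_int01 h2]. Qed.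

Lemma gamma0_ge0 t : 0 <= gamma0 sigma1 sigma2 t m.
Proof. by rewrite !addr_ge0 ?normc_nneg. Qed.

Lemma ac_gamma0 : ac_real (fun t => gamma0 sigma1 sigma2 t m).
Proof.
have aco f s : in_Lp p%:E f -> ac_real (fun t => normc (osc f s m t)).
  by move=> hf; apply/ac_real_normc/ac_osc/Lp_cintegrable.
by apply: ac_realD; apply: ac_realD; exact: aco.
Qed.

Lemma gamma_ge0 : 0 <= gamma p sigma1 sigma2 m.
Proof. by rewrite !addr_ge0 ?Lpnorm_ge0. Qed.

Lemma a2_ge0 : 0 <= a2 p sigma1 sigma2.
Proof. by rewrite addr_ge0 ?Lpnorm_ge0. Qed.

Lemma gamma1_ge0 : 0 <= gamma1 sigma1 sigma2 m.
Proof. by apply: I01_ge0 => t; rewrite mulr_ge0 ?sqr_ge0// sigma0_ge0. Qed.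

(** Both factors are sums, of two and of four terms; Hoelder's inequality
    applies to each of the eight products. *)
Lemma int_sigma0_gamma0_le :
  I01 (fun t => sigma0 sigma1 sigma2 t * gamma0 sigma1 sigma2 t m) <=
  a2 p sigma1 sigma2 * gamma p sigma1 sigma2 m.
Proof.
have aco f s : in_Lp p%:E f -> ac_real (fun t => normc (osc f s m t)).
  by move=> hf; apply/ac_real_normc/ac_osc/Lp_cintegrable.
have io f g s : in_Lp p%:E f -> in_Lp p%:E g ->
    int01 (fun t => normc (f t) * normc (osc g s m t)).
  by move=> hf hg; apply: int01_ac_mul; [exact: Lp_int01 hf|exact: aco].
have ho f g s : in_Lp p%:E f -> in_Lp p%:E g ->
    I01 (fun t => normc (f t) * normc (osc g s m t)) <=
    Lpnorm p%:E f * Lpnorm (hoelder_conjugate p%:E) (osc g s m).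
  move=> hf hg; have [M M0 gM] := ac_bounded (ac_osc s m (Lp_cintegrable hg)).
  by apply: hoelder01 gM => //; exact: osc_cmeasurable.
have h4 f : in_Lp p%:E f ->
    int01 (fun t => normc (f t) * gamma0 sigma1 sigma2 t m) /\
    I01 (fun t => normc (f t) * gamma0 sigma1 sigma2 t m) <=
    Lpnorm p%:E f * gamma p sigma1 sigma2 m.
  move=> hf; have -> : (fun t => normc (f t) * gamma0 sigma1 sigma2 t m) = (fun t =>
      (normc (f t) * normc (osc sigma1 (-2) m t) + normc (f t) * normc (osc sigma1 2 m t)) +
      (normc (f t) * normc (osc sigma2 (-2) m t) + normc (f t) * normc (osc sigma2 2 m t))).
    by apply/funext => t; rewrite /gamma0 !mulrDr.
  rewrite /gamma !mulrDr.
  have i1 g : in_Lp p%:E g -> int01 (fun t => normc (f t) * normc (osc g (-2) m t) +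
       normc (f t) * normc (osc g 2 m t)).
    by move=> hg; apply: int01D; exact: io.
  split; first by apply: int01D; exact: i1.
  rewrite I01D; [|exact: i1..]; rewrite !I01D; [|exact: io..].
  by apply: lerD; apply: lerD; exact: ho.
rewrite /a2 mulrDl; have [i1 b1] := h4 _ h1; have [i2 b2] := h4 _ h2.
have -> : (fun t => sigma0 sigma1 sigma2 t * gamma0 sigma1 sigma2 t m) =
    (fun t => normc (sigma1 t) * gamma0 sigma1 sigma2 t m +
              normc (sigma2 t) * gamma0 sigma1 sigma2 t m).
  by apply/funext => t; rewrite mulrDl.
by rewrite I01D// lerD.
Qed.

(** When a1 = 0 both sides vanish: gamma0 is bounded, so gamma1 is at most a
    constant times the integral of sigma0, which is a1. *)
Lemma gamma1_divE : gamma1 sigma1 sigma2 m =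
  (a1 sigma1 sigma2)^-1 * (a1 sigma1 sigma2 * gamma1 sigma1 sigma2 m).
Proof.
have [a10|a10] := eqVneq (a1 sigma1 sigma2) 0; last by rewrite mulrA mulVf// mul1r.
rewrite a10 mul0r mulr0; apply/eqP; rewrite eq_le gamma1_ge0 andbT.
have [M M0 gM] := ac_real_bounded ac_gamma0.
have ig2 : int01 (fun t => sigma0 sigma1 sigma2 t * gamma0 sigma1 sigma2 t m ^+ 2).
  have := @int01_ac_mul R _ (fun t => gamma0 sigma1 sigma2 t m ^+ 2) int01_sigma0.
  apply; under eq_fun do rewrite expr2.
  exact: (ac_realM ac_gamma0 ac_gamma0).
rewrite (@le_trans _ _ (I01 (fun t => M ^+ 2 * sigma0 sigma1 sigma2 t)))//.
  rewrite /gamma1; apply: le_Rintegral; [exact: measurable01|exact: ig2|exact: int01Z int01_sigma0|].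
  move=> t /=; rewrite in_itv/= => t01; rewrite mulrC ler_wpM2r ?sigma0_ge0//.
  by rewrite lerXn2r ?nnegrE ?gamma0_ge0// (le_trans (ler_norm _))// gM.
by rewrite I01Z -?a1E ?a10 ?mulr0//; exact: int01_sigma0.
Qed.

End gamma_bounds.

(** * Entries of the matrices *)

Section matrix_entries.
Context {R : realType}.
Implicit Types (A B : 'M[R[i]]_2) (x t : R).

Definition i0 : 'I_2 := ord0.
Definition i1 : 'I_2 := lift ord0 ord0.

Lemma ord2P (i : 'I_2) : i = i0 \/ i = i1.
Proof.
by case: i => [[|[|//]] h]; [left|right]; exact: val_inj.
Qed.

Lemma mulmx2E A B i j : (A *m B) i j = A i i0 * B i0 j + A i i1 * B i1 j.
Proof. by rewrite mxE big_ord_recl big_ord1. Qed.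

Lemma mxsubE A B i j : (A - B) i j = A i j - B i j.
Proof. by rewrite !mxE. Qed.

Lemma normMC_le A c : (forall i j, normc (A i j) <= c) -> normMC A <= 4 * c.
Proof.
move=> h; rewrite /normMC !big_ord_recl !big_ord0 !addr0.
have := h i0 i0; have := h i0 i1; have := h i1 i0; have := h i1 i1; rewrite /i0 /i1.
move: (normc _) (normc _) (normc _) (normc _) => a b c' d'; lra.
Qed.

Lemma normMC01_le (F : R -> 'M[R[i]]_2) c :
  (forall x i j, 0 <= x <= 1 -> normc (F x i j) <= c) -> (normMC01 F <= (4 * c)%:E)%E.
Proof.
move=> h; rewrite /normMC01.
apply: (@le_trans _ _ (\sum_(i < 2) \sum_(j < 2) c%:E)%E).
  apply: lee_sum => i _; apply: lee_sum => j _; apply: ge_ereal_sup => _ [x x01 <-].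
  by rewrite lee_fin h//; move: x01; rewrite /= in_itv.
rewrite !big_ord_recl !big_ord0 !adde0 -!EFinD lee_fin; lra.
Qed.

Lemma expxA00 (m : R[i]) x : expxA m x i0 i0 = cexp ('i%C * m * x%:C).
Proof. by rewrite expxAE mxE. Qed.
Lemma expxA11 (m : R[i]) x : expxA m x i1 i1 = cexp (- ('i%C * m) * x%:C).
Proof. by rewrite expxAE mxE mulNr. Qed.
Lemma expxA01 (m : R[i]) x : expxA m x i0 i1 = 0.
Proof. by rewrite expxAE mxE. Qed.
Lemma expxA10 (m : R[i]) x : expxA m x i1 i0 = 0.
Proof. by rewrite expxAE mxE. Qed.

End matrix_entries.

Section dirac.
Context {R : realType}.
Notation mu := (@lebesgue_measure R).
Notation int01 h := (mu.-integrable `[0, 1]%classic (EFin \o h)).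
Notation I01 h := (\int[mu]_(t in `[0, 1]) h t).
Local Notation D01 := (`[0%R : R, 1%R]%classic : set (measurableTypeR R)).
Variables (sigma1 sigma2 : R -> R[i]) (m : R[i]).
Hypotheses (int1 : cintegrable_on D01 sigma1) (int2 : cintegrable_on D01 sigma2).
Local Notation w := ('i%C * m).

Lemma two_i_mu : (2 : R)%:C * 'i%C * m = w + w.
Proof. rewrite rmorph_nat; ring. Qed.

Lemma minus_two_i_mu : (- 2 : R)%:C * 'i%C * m = - (w + w).
Proof. rewrite rmorphN rmorph_nat; ring. Qed.

Lemma Jtilde_entries x t :
  [/\ Jtilde sigma1 sigma2 x t i0 i0 =
        cintegral 0 (x - t) (fun r => sigma1 (t + r) * sigma2 r),
      Jtilde sigma1 sigma2 x t i0 i1 = 0, Jtilde sigma1 sigma2 x t i1 i0 = 0 &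
      Jtilde sigma1 sigma2 x t i1 i1 =
        cintegral 0 (x - t) (fun r => sigma2 (t + r) * sigma1 r)].
Proof.
have c0 : cintegral 0 (x - t) (fun=> 0) = 0 :> R[i].
  by rewrite /cintegral/= !Rintegral_cst ?mul0r//; exact: measurable_itv.
rewrite /Jtilde /mxintegral; split; rewrite mxE; try (rewrite -[RHS]c0);
  by apply: eq_cintegral => r _; rewrite mulmx2E !mxE/= ?(mul0r, mulr0, addr0, add0r).
Qed.

Lemma D0_00 x : 0 <= x <= 1 -> D0 sigma1 sigma2 x m i0 i0 =
  cexp (w * x%:C) * second_term (- (w + w)) sigma1 (w + w) sigma2 x.
Proof.
move=> x01; rewrite -diagonal_second_term// /D0 /mxintegral mxE.
apply: eq_cintegral => t _; rewrite mulmx2E expxA00 expxA01 mul0r addr0.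
have [J00 _ _ _] := Jtilde_entries x t.
by rewrite mxE J00 !mxE/= oppr0 add0r.
Qed.

Lemma D0_11 x : 0 <= x <= 1 -> D0 sigma1 sigma2 x m i1 i1 =
  cexp (- w * x%:C) * second_term (- (- w - w)) sigma2 (- w - w) sigma1 x.
Proof.
move=> x01; rewrite -diagonal_second_term// /D0 /mxintegral mxE.
apply: eq_cintegral => t _; rewrite mulmx2E expxA11 expxA10 mul0r add0r.
have [_ _ _ J11] := Jtilde_entries x t.
by rewrite mxE J11 !mxE/= oppr0 add0r.
Qed.

Lemma D0_off_diagonal (z : R[i]) f x : cintegrable_on D01 f -> 0 <= x <= 1 ->
  cintegral 0 x (fun t => cexp (z * (x - 2 * t)%:C) * - f t) =
  - (cexp (z * x%:C) * modprim (- (z + z)) f x).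
Proof.
move=> intf /andP[x0 x1].
rewrite -mulNr -cintegralMl; last exact: cintegrable_itv (cintegrable_modulated _ intf).
apply: eq_cintegral => t /andP[t0 tx].
rewrite /modulated cutE; last by rewrite t0 (le_trans tx).
have -> : cexp (z * (x - 2 * t)%:C) = cexp (z * x%:C) * cexp (- (z + z) * t%:C).
  rewrite -cexpD; congr cexp; rewrite rmorphB rmorphM/= rmorph_nat; ring.
ring.
Qed.

Lemma D0_01 x : 0 <= x <= 1 -> D0 sigma1 sigma2 x m i0 i1 =
  - (cexp (w * x%:C) * modprim (- w - w) sigma1 x).
Proof.
move=> x01; rewrite -opprD -D0_off_diagonal// /D0 /mxintegral mxE.
apply: eq_cintegral => t _; rewrite mulmx2E expxA00 expxA01 mul0r addr0.
have [_ J01 _ _] := Jtilde_entries x t.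
by rewrite mxE J01 !mxE/= addr0.
Qed.

Lemma D0_10 x : 0 <= x <= 1 -> D0 sigma1 sigma2 x m i1 i0 =
  - (cexp (- w * x%:C) * modprim (w + w) sigma2 x).
Proof.
move=> x01; rewrite -[w in modprim (w + _)]opprK -[X in - - w + X]opprK -opprD -D0_off_diagonal//.
rewrite /D0 /mxintegral mxE.
apply: eq_cintegral => t _; rewrite mulmx2E expxA11 expxA10 mul0r add0r.
have [_ _ J10 _] := Jtilde_entries x t.
by rewrite mxE J10 !mxE/= addr0.
Qed.

Lemma dirac_entries D : dirac_solution sigma1 sigma2 m D ->
  {ae mu, forall t : R, 0 <= t <= 1 ->
    [/\ cderive_at (fun t => D t i0 i0) t (w * D t i0 i0 - sigma1 t * D t i1 i0),
        cderive_at (fun t => D t i1 i0) t (- (w * D t i1 i0) - sigma2 t * D t i0 i0),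
        cderive_at (fun t => D t i0 i1) t (w * D t i0 i1 - sigma1 t * D t i1 i1) &
        cderive_at (fun t => D t i1 i1) t (- (w * D t i1 i1) - sigma2 t * D t i0 i1)]}.
Proof.
move=> [_ hD _]; apply: filterS hD => t hD t01.
have [D' dD' eD'] := hD t01.
have E i j : D' i j = (Amu m *m D t) i j - (J sigma1 sigma2 t *m D t) i j.
  by rewrite -eD' mxE addrK.
have d i j z : D' i j = z -> cderive_at (fun t => D t i j) t z.
  by move=> <-; exact: dD'.
by split; apply: d; rewrite E !mulmx2E !mxE/=; ring.
Qed.

End dirac.

(** * The remainders *)

Section remainder_bounds.
Context {R : realType}.
Notation mu := (@lebesgue_measure R).
Notation I01 h := (\int[mu]_(t in `[0, 1]) h t).
Variables (p d : R) (sigma1 sigma2 : R -> R[i]) (m : R[i]) (D : R -> 'M[R[i]]_2).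
Hypotheses (p1 : 1 <= p) (h1 : in_Lp p%:E sigma1) (h2 : in_Lp p%:E sigma2).
Hypotheses (md : strip d m) (hD : dirac_solution sigma1 sigma2 m D).
Local Notation w := ('i%C * m).
Local Notation sg := (sigma0 sigma1 sigma2).
Local Notation G x := (gamma0 sigma1 sigma2 x m).
Let C := expR d * column_cst (expR (2 * d)) (I01 sg).
Let B := I01 (fun t => sg t * G t).
Let B2 := gamma1 sigma1 sigma2 m.

Lemma Re_i_mu : `|complex.Re w| <= d.
Proof. by rewrite ReM/= mul0r mul1r sub0r normrN; exact: md. Qed.

Lemma solution_at0 i j : D 0 i j = (i == j)%:R.
Proof. by have [_ _ ->] := hD; rewrite mxE. Qed.

(** [dirac_column] is applied to the first column with w = i mu, and to the
    second one, read from bottom to top, with - w and the two potentials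
    exchanged. *)
Lemma solution_entries x : 0 <= x <= 1 ->
  [/\ forall i j, normc (D x i j) <= C,
      forall i j, normc ((D x - expxA m x) i j) <= C * (B + G x) &
      forall i j, normc ((D x - expxA m x - D0 sigma1 sigma2 x m) i j) <=
        C * (G x * B + (B ^+ 2 + B2))].
Proof.
move=> x01; have [acD _ _] := hD.
have c1 := Lp_cintegrable p1 h1; have c2 := Lp_cintegrable p1 h2.
have isg := int01_sigma0 p1 h1 h2.
have sg0 t : 0 <= sg t := sigma0_ge0 sigma1 sigma2 t.
have G0 t : 0 <= G t := gamma0_ge0 sigma1 sigma2 m t.
have acG := ac_gamma0 m p1 h1 h2.
have s1g t : normc (sigma1 t) <= sg t by rewrite lerDl normc_nneg.
have s2g t : normc (sigma2 t) <= sg t by rewrite lerDr normc_nneg.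
have dE := dirac_entries hD.
have Rw := Re_i_mu.
have RNw : `|complex.Re (- w)| <= d by rewrite ReN normrN.
have col1 := @dirac_column R d w sigma1 sigma2 (fun t => D t i0 i0) (fun t => D t i1 i0)
  sg (fun t => G t) Rw c1 c2 isg sg0 G0 acG s1g s2g.
have col2 := @dirac_column R d (- w) sigma2 sigma1 (fun t => D t i1 i1) (fun t => D t i0 i1)
  sg (fun t => G t) RNw c2 c1 isg sg0 G0 acG s2g s1g.
have S1 t : 0 <= t <= 1 -> normc (modprim (w + w) sigma2 t) <= G t.
  move=> /andP[_ t1]; rewrite -two_i_mu -oscE//.
  by rewrite /gamma0 addrC -addrA [X in _ <= X]addrC -addrA lerDl !addr_ge0 ?normc_nneg.
have S2 t : 0 <= t <= 1 -> normc (modprim (- w - w) sigma1 t) <= G t.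
  move=> /andP[_ t1]; rewrite -opprD -minus_two_i_mu -oscE//.
  by rewrite /gamma0 -addrA lerDl !addr_ge0 ?normc_nneg.
have {col1} := col1 S1 (acD i0 i0) (acD i1 i0).
rewrite !solution_at0/= => /(_ erefl erefl) col1.
have {col2} := col2 S2 (acD i1 i1) (acD i0 i1).
rewrite !solution_at0/= => /(_ erefl erefl) col2.
have {col1} := col1 _ x x01; have {col2} := col2 _ x x01.
pose B2' := I01 (fun t => sg t * G t ^+ 2); have B2E : B2' = B2 by [].
rewrite -/C -/B -/B2' B2E => col2 col1.
have [|X2 Y2 [rX2 rY2] oY2 oX2] := col2.
  by apply: filterS dE => t dE t01; have [_ _ dY dX] := dE t01; rewrite !mulNr opprK.
have [|X1 Y1 [rX1 rY1] oY1 oX1] := col1.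
  by apply: filterS dE => t dE t01; have [] := dE t01.
have B0 : 0 <= B by apply: I01_ge0 => t; rewrite mulr_ge0.
have C0 : 0 <= C by exact: le_trans (normc_nneg _) X1.
have B20 : 0 <= B2 by exact: gamma1_ge0.
have diag z : z <= C * B -> z <= C * (B + G x).
  by move=> h; rewrite (le_trans h)// ler_wpM2l// lerDl; exact: G0.
have diag2 z : z <= C * (B ^+ 2 + B2) -> z <= C * (G x * B + (B ^+ 2 + B2)).
  move=> h; rewrite (le_trans h)// ler_wpM2l// lerDr; exact: (mulr_ge0 (G0 x) B0).
split=> i j; have [->|->] := ord2P i; have [->|->] := ord2P j => //.
- rewrite mxsubE expxA00; exact: diag.
- by rewrite mxsubE expxA01 subr0.
- by rewrite mxsubE expxA10 subr0.
- rewrite mxsubE expxA11; exact: diag.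
- by rewrite !mxsubE expxA00 (D0_00 m c1 c2 x01); apply: diag2; exact: oX1.
- by rewrite !mxsubE expxA01 D0_01// subr0 opprK; move: oY2; rewrite opprK.
- by rewrite !mxsubE expxA10 D0_10// subr0 opprK.
- by rewrite !mxsubE expxA11 (D0_11 m c1 c2 x01); apply: diag2; exact: oX2.
Qed.

End remainder_bounds.

(** Here b stands for the integral of sigma0 gamma0, and the last summand on the
    left is gamma1 in the form of [gamma1_divE]: the definition of gamma2
    contains the products a2^2 gamma^2 and a1 gamma1 only. *)
Lemma remainder_arith (R : realFieldType) (a a' b g G g1 : R) :
  0 <= a -> 0 <= a' -> 0 <= b -> b <= a * g -> 0 <= g -> 0 <= G -> 0 <= g1 ->
  G * b + (b ^+ 2 + a'^-1 * (a' * g1)) <=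
  (1 + a + a'^-1) * (g * G + (a ^+ 2 * g ^+ 2 + a' * g1)).
Proof.
move=> a0 a'0 b0 bg g0 G0 g10.
have ia' : 0 <= a'^-1 by rewrite invr_ge0.
have hX : G * b <= a * (g * G).
  by rewrite [leRHS](_ : _ = G * (a * g)); [rewrite ler_wpM2l|ring].
have hY : b ^+ 2 <= a ^+ 2 * g ^+ 2.
  by rewrite -exprMn lerXn2r ?nnegrE// mulr_ge0.
move: hX hY; have : 0 <= g * G by rewrite mulr_ge0.
have : 0 <= a ^+ 2 * g ^+ 2 by rewrite mulr_ge0// sqr_ge0.
have : 0 <= a' * g1 by rewrite mulr_ge0.
move: (g * G) (a ^+ 2 * g ^+ 2) (a' * g1) (G * b) (b ^+ 2) => X Y Z u v Z0 Y0 X0 hX hY.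
have := mulr_ge0 a0 Y0; have := mulr_ge0 a0 Z0.
have := mulr_ge0 ia' X0; have := mulr_ge0 ia' Y0; lra.
Qed.

Section exponential_entries.
Context {R : realType}.
Variable m : R[i].

Lemma ac_expxA i j : abs_continuous01 (fun x => expxA m x i j).
Proof.
have [->|->] := ord2P i; have [->|->] := ord2P j.
- by under eq_fun do rewrite expxA00; exact: ac_cexp.
- by under eq_fun do rewrite expxA01; exact: ac_cst.
- by under eq_fun do rewrite expxA10; exact: ac_cst.
- by under eq_fun do rewrite expxA11; exact: ac_cexp.
Qed.

Lemma normc_expxA_le (d x : R) i j : strip d m -> 0 <= x <= 1 ->
  normc (expxA m x i j) <= expR d.
Proof.
move=> md x01; have Rw := Re_i_mu md.
have [->|->] := ord2P i; have [->|->] := ord2P j;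
  rewrite ?expxA01 ?expxA10 ?normc0 ?expR_ge0 // ?expxA00 ?expxA11.
  by rewrite (le_trans (normc_cexp_le _ x01))// ler_expR.
by rewrite (le_trans (normc_cexp_le _ x01))// ler_expR ReN normrN.
Qed.

End exponential_entries.

Theorem corollary2p3 (R : realType) (p : R) (sigma1 sigma2 : R -> R[i])
    (hp : 1 <= p < 2)
    (hsigma1 : in_Lp p%:E sigma1) (hsigma2 : in_Lp p%:E sigma2) :
  forall d : R, 0 < d ->
  exists c0 c1 c2 : R,
  forall mu : R[i], strip d mu ->
  forall D : R -> 'M[R[i]]_2, dirac_solution sigma1 sigma2 mu D ->
  (exists Rem : R -> 'M[R[i]]_2,
    [/\ forall x : R, 0 <= x <= 1 -> D x = expxA mu x + Rem x,
        forall i j, continuous01 (fun x => Rem x i j),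
        (normMC01 Rem <= c0%:E)%E
      & forall x : R, 0 <= x <= 1 ->
          normMC (Rem x)
            <= c1 * (gamma p sigma1 sigma2 mu + gamma0 sigma1 sigma2 x mu)]) /\
  (exists Rem0 : R -> 'M[R[i]]_2,
    (forall x : R, 0 <= x <= 1 ->
       D x = expxA mu x + D0 sigma1 sigma2 x mu + Rem0 x) /\
    (forall x : R, 0 <= x <= 1 ->
       normMC (Rem0 x)
         <= c2 * (gamma p sigma1 sigma2 mu * gamma0 sigma1 sigma2 x mu
                  + gamma2 p sigma1 sigma2 mu))).
Proof.
move=> d d0; have /andP[p1 _] := hp.
pose A := \int[lebesgue_measure]_(t in `[0, 1]) sigma0 sigma1 sigma2 t.
pose C := expR d * column_cst (expR (2 * d)) A.
pose a := a2 p sigma1 sigma2; pose a' := a1 sigma1 sigma2.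
exists (4 * (C + expR d)), (4 * (C * (1 + a))), (4 * (C * (1 + a + a'^-1))).
move=> m md D hD; have entries := solution_entries p1 hsigma1 hsigma2 md hD.
have gm := gamma_ge0 p sigma1 sigma2 m; have aa := a2_ge0 p sigma1 sigma2.
have g1 := gamma1_ge0 sigma1 sigma2 m.
have Ba := int_sigma0_gamma0_le m p1 hsigma1 hsigma2.
have B0 : 0 <= \int[lebesgue_measure]_(t in `[0, 1])
    (sigma0 sigma1 sigma2 t * gamma0 sigma1 sigma2 t m).
  by apply: I01_ge0 => t; rewrite mulr_ge0 ?sigma0_ge0 ?gamma0_ge0.
have C0 : 0 <= C.
  have [|h _ _] := entries 0; first by rewrite lexx ler01.
  exact: le_trans (normc_nneg _) (h i0 i0).
have a'0 : 0 <= a'^-1.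
  by rewrite invr_ge0 /a' (a1E p1 hsigma1 hsigma2); apply: I01_ge0 => t; exact: sigma0_ge0.
have g1E := gamma1_divE m p1 hsigma1 hsigma2.
split.
- exists (fun x => D x - expxA m x); split.
  + by move=> x x01; rewrite addrC subrK.
  + move=> i j; apply: ac_continuous01.
    rewrite (_ : (fun x => _) = (fun x => D x i j + - expxA m x i j)); last first.
      by apply/funext => x; rewrite mxsubE.
    by apply: acD; [case: hD|apply: acN; exact: ac_expxA].
  + apply: normMC01_le => x i j x01; rewrite mxsubE.
    have [h _ _] := entries x x01.
    rewrite (le_trans (normc_sub _ _))// lerD ?h//.
    exact: normc_expxA_le.
  + move=> x x01; have [_ h _] := entries x x01; have G0 := gamma0_ge0 sigma1 sigma2 m x.
    rewrite -mulrA; apply: (le_trans (normMC_le h)); rewrite ler_pM2l// -/A -/C.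
    rewrite -[leRHS]mulrA; apply: (ler_wpM2l C0).
    rewrite mulrDl mul1r [leLHS]addrC.
    apply: lerD; first by rewrite lerDr.
    by rewrite (le_trans Ba)// ler_wpM2l// lerDl.
- exists (fun x => D x - expxA m x - D0 sigma1 sigma2 x m); split.
    by move=> x x01; rewrite addrC -[D x - _ - _]addrA -opprD subrK.
  move=> x x01; have [_ _ h] := entries x x01; have G0 := gamma0_ge0 sigma1 sigma2 m x.
  rewrite -mulrA; apply: (le_trans (normMC_le h)); rewrite ler_pM2l// -/A -/C.
  rewrite -[leRHS]mulrA; apply: (ler_wpM2l C0).
  rewrite /gamma2 -/a -/a' {1}g1E -/a'.
  have a'p : 0 <= a' by rewrite -invr_ge0.
  exact: remainder_arith.
Qed.
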